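(* Let $\gamma>0$, $d_n=(\log n)^\gamma$, and let $\eta_n=(r_n-r_n^{-1})/2$, where $r_n=\exp(d_n^{-\alpha})$ for some $0<\alpha<\min(1,1/\gamma)$. Let $A_n$ be the adjacency matrix of the random regular graph $G(n,d_n)$. Fix $\delta>0$, and let $T_n\subseteq\{1,2,\dots,n\}$ be a deterministic sequence of nonempty sets of size $L_n=o(\eta_n^{-1})$. (i) Let $\Omega_1(n)$ be the event that some normalized (unit $\ell^2$-norm) eigenvector of $A_n$ is $(T_n,\delta)$ localized. Then, for all sufficiently large $n$, $$P\bigl((\Omega_1(n))^c\bigr)\ \ge\ e^{-L_n\eta_n/d_n}\Bigl(1-o\Bigl(\frac1{d_n}\Bigr)\Bigr)=1-o\Bigl(\frac{1}{d_n}\Bigr).$$ (ii) Define $$\zeta_n=\frac14\,\frac{\log n}{\log(d_n-1)}-4 ,\qquad n\ge 2,$$ and let $J(n)$ be the (random) set of all vertices of $G(n,d_n)$ whose $\zeta_n$-neighborhood is free of cycles. Then $$P\Bigl(\frac{|J(n)|}{n}\ge 1-\frac{\eta_n}{d_n}\Bigr)=1-o\Bigl(\frac1n\Bigr).$$ Moreover, for all sufficiently large $n$, the event that $T_n\subset J(n)$ and some normalized eigenvector of $A_n$ is $(T_n,\delta)$ localized has probability zero.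
   Context: $G(n,d)$ denotes a graph chosen uniformly at random from the set of all labeled simple graphs with vertex set $\{1,\dots,n\}$ in which every vertex has degree $d$. Here $d_n=(\log n)^\gamma$ is understood as an integer (suitably rounded) for which such graphs exist. The adjacency matrix is the symmetric $0/1$ matrix recording edges. Localization: for $T\subseteq\{1,\dots,n\}$ with $|T|\ge1$ and $\delta>0$, a vector $v=(v(1),\dots,v(n))\in\mathbb{R}^n$ with $\|v\|_2=1$ is $(T,\delta)$ localized if $\sum_{j\in T}|v(j)|^2\ge 1-\delta$. The $r$-neighborhood of a vertex $i$ is the subgraph whose vertices are those at graph distance at most $r$ from $i$ and whose edges are all edges of the graph between those vertices.
   Formalization: The formal theorem assumes 0 < δ < 1 instead of δ > 0; for δ ≥ 1 every unit vector is (T_n, δ) localized, so (i) and the final claim of (ii) fail. *)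

(* Defs.v *)
From mathcomp Require Import all_boot all_order all_algebra.
From mathcomp Require Import all_classical all_reals all_analysis.

Set Implicit Arguments.
Unset Strict Implicit.
Unset Printing Implicit Defensive.

Import Order.TTheory GRing.Theory Num.Theory.
Import numFieldNormedType.Exports.

Local Open Scope ring_scope.

(* A labelled simple graph on the vertex type T is its set of edges, each edge
   being an unordered pair of distinct vertices. *)
Section Graphs.
Variable T : finType.
Implicit Types (E : {set {set T}}) (x y : T).

Definition simple_graph E := [forall e in E, #|e| == 2%N].

Definition adj E : rel T := fun x y => [set x; y] \in E.

Definition deg E x := #|[set y | adj E x y]|.

(* A cycle has at least 3 vertices, all distinct. *)
Definition acyclic E :=
  forall c : seq T, (2 < size c)%N -> ~~ ucycleb (adj E) c.

End Graphs.

Definition regular_graphs (n d : nat) : {set {set {set 'I_n}}} :=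
  [set E | simple_graph E && [forall x, deg E x == d]].

Section RealValued.
Variable R : realType.

(* Graph distance; it is +oo between different connected components. *)
Definition gdist (T : finType) (E : {set {set T}}) (x y : T) : \bar R :=
  ereal_inf [set ((size p)%:R : R)%:E |
             p in [set p | path (adj E) x p /\ last x p = y]]%classic.

Definition gball (T : finType) (E : {set {set T}}) (r : R) (x : T) : {set T} :=
  [set y | (gdist E x y <= r%:E)%E].

(* The edges of the r-neighborhood of x, i.e. of the subgraph of E induced by
   the ball of (real) radius r around x. *)
Definition nbhd_graph (T : finType) (E : {set {set T}}) (r : R) (x : T) :
    {set {set T}} :=
  [set e in E | e \subset gball E r x].

Definition acyclic_vertices (T : finType) (E : {set {set T}}) (r : R) :
    {set T} :=
  [set x | `[< acyclic (nbhd_graph E r x) >]].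

Definition adjmx (n : nat) (E : {set {set 'I_n}}) : 'M[R]_n :=
  \matrix_(i, j) (adj E i j)%:R.

Definition l2norm (n : nat) (v : 'rV[R]_n) : R :=
  Num.sqrt (\sum_j `|v 0 j| ^+ 2).

Definition localized (n : nat) (T : {set 'I_n}) (delta : R) (v : 'rV[R]_n) :=
  l2norm v = 1 /\ 1 - delta <= \sum_(j in T) `|v 0 j| ^+ 2.

(* Row eigenvectors are the same as column eigenvectors for a symmetric matrix
   such as an adjacency matrix; v is nonzero because its norm is 1. *)
Definition has_localized_eigenvector (n : nat) (A : 'M[R]_n) (T : {set 'I_n})
    (delta : R) :=
  exists (a : R) (v : 'rV[R]_n),
    (v <= eigenspace A a)%MS /\ localized T delta v.

Definition unif_prob (X : finType) (S : {set X}) (Q : X -> Prop) : R :=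
  #|[set x in S | `[< Q x >]]|%:R / #|S|%:R.

Definition prob_reg (n d : nat) (Q : {set {set 'I_n}} -> Prop) : R :=
  unif_prob (regular_graphs n d) Q.

Definition eta_n (alpha : R) (d : nat) : R :=
  let r := expR (d%:R `^ (- alpha)) in (r - r^-1) / 2.

Definition zeta_n (n d : nat) : R := 1 / 4 * (ln n%:R / ln (d%:R - 1)) - 4.

End RealValued.

Arguments prob_reg R [n] d Q.
Arguments adjmx R [n] E.

(* Main.v *)
Require Import Defs.
From mathcomp Require Import all_boot all_order all_algebra.
From mathcomp Require Import zify ring lra.

(* Parts (i) and (ii) follow from two facts about the acyclic radius r = zeta_n.

   Deterministic: if the r-ball around x is a tree, the sums F(k) of an eigenvector with
   eigenvalue a over the spheres around x satisfy F(k+1) = a F(k) - (d-1) F(k-1), with F(0) = v(x).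
   The normalised solutions of this recurrence do not decay, so by Cauchy-Schwarz every
   two consecutive spheres carry mass at least v(x)^2 / 16, whence v(x)^2 <= 32 / (r - 1) for unit
   v. As 1 / eta <= r - 1 eventually, a set of o(1 / eta) such vertices carries mass o(1).

   Probabilistic: if the r-ball around x is not a tree, x is the end of a lollipop (a path whose
   last vertex is joined back to an earlier one) with at most 2r + 2 vertices. Edge switching shows
   that a fixed set of m edges, m not too large, is contained in the random graph with probability
   at most (2d/n)^m; a lollipop has as many edges as vertices, so a given vertex carries one with
   probability at most n^(-1/3), which gives (i). If more than n eta / d vertices carry one,
   a greedy choice produces many quadruples of vertex-disjoint lollipops, and Markov's inequality
   for the number of these quadruples gives the o(1/n) of (ii). *)

Set Implicit Arguments.
Unset Strict Implicit.
Unset Printing Implicit Defensive.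

Import Order.TTheory GRing.Theory Num.Theory.

(** * Balls, spheres and lollipops *)

Section Balls.
Variable T : finType.
Implicit Types (E : {set {set T}}) (x y z : T) (k : nat) (s p : seq T).

Lemma adj_sym E : symmetric (adj E).
Proof. by move=> x y; rewrite /adj setUC. Qed.

Lemma adj_irrefl E x : simple_graph E -> adj E x x = false.
Proof.
move=> /forallP /(_ [set x; x]) /implyP hE; apply/negP => /hE.
by rewrite setUid cards1.
Qed.

Fixpoint nball E k x : {set T} :=
  if k is k'.+1 then nball E k' x :|: [set z | [exists y in nball E k' x, adj E y z]]
  else [set x].

Lemma nballS E k x : nball E k x \subset nball E k.+1 x.
Proof. exact: subsetUl. Qed.

Lemma sub_ball E k l x : k <= l -> nball E k x \subset nball E l x.
Proof.
move=> /subnK <-; elim: (l - k) => [|i IH] //.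
by apply: subset_trans IH _; rewrite addSn nballS.
Qed.

Lemma nball_adj E k x y z : y \in nball E k x -> adj E y z -> z \in nball E k.+1 x.
Proof. by move=> yB yz; rewrite !inE; apply/orP; right; apply/existsP; exists y; rewrite yB. Qed.

Lemma nballP E k x y :
  reflect (exists p, [/\ path (adj E) x p, last x p = y & size p <= k]) (y \in nball E k x).
Proof.
apply: (iffP idP).
  elim: k y => [|k IH] y /=; first by rewrite inE => /eqP ->; exists [::].
  rewrite inE => /orP [/IH[p [? ? ?]]|]; first by exists p; split => //; exact: leqW.
  rewrite inE => /existsP[z /andP[/IH[p [xp lp sp]] zy]].
  by exists (rcons p y); rewrite rcons_path xp lp zy last_rcons size_rcons.
case=> p; elim/last_ind: p k y => [|p z IH] k y [].
  by move=> _ /= <- _; apply: (subsetP (sub_ball E x (leq0n k))); rewrite inE.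
rewrite rcons_path last_rcons size_rcons => /andP[xp lz] <-; case: k => // k sk.
by apply: nball_adj lz; apply: IH.
Qed.

Lemma leq_card_bigcup (I U : finType) (P : pred I) (F : I -> {set U}) :
  #|\bigcup_(i | P i) F i| <= \sum_(i | P i) #|F i|.
Proof.
elim/big_rec2: _ => [|i n B _ IH]; first by rewrite cards0.
by apply: leq_trans (leq_card_setU _ _) _; rewrite leq_add2l.
Qed.

Lemma card_bigcup_le (I U : finType) (A : {set I}) (F : I -> {set U}) m :
  (forall i, i \in A -> #|F i| <= m) -> #|\bigcup_(i in A) F i| <= #|A| * m.
Proof.
move=> hF; apply: leq_trans (leq_card_bigcup _ _) _.
by rewrite -sum_nat_const; apply: leq_sum.
Qed.

(** Each step adds at most [d] new vertices for every vertex already in the ball, so the size grows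
    by a factor of at most [d.+1]. *)
Lemma card_ball E d k x : (forall y, deg E y <= d) -> #|nball E k x| <= d.+1 ^ k.
Proof.
move=> hd; elim: k => [|k IH] /=; first by rewrite cards1.
have -> : [set z | [exists y in nball E k x, adj E y z]] =
          \bigcup_(y in nball E k x) [set z | adj E y z].
  apply/setP => z; rewrite inE; apply/existsP/bigcupP => -[y].
    by case/andP=> yB yz; exists y; rewrite ?inE.
  by move=> yB; rewrite inE => yz; exists y; rewrite yB.
apply: leq_trans (leq_card_setU _ _) _.
apply: (@leq_trans (#|nball E k x| * d.+1)); last by rewrite expnSr leq_mul2r IH orbT.
by rewrite mulnS leq_add2l; apply: card_bigcup_le => y _; apply: hd.
Qed.

Definition sphere E k x : {set T} :=
  if k is k'.+1 then nball E k x :\: nball E k' x else [set x].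

Lemma sphere_ball E k x : sphere E k x \subset nball E k x.
Proof. by case: k => [|k] //; apply: subsetDl. Qed.

(* The obstruction to the ball of radius r around x being a tree whose levels are the spheres. *)
Definition branching E r x :=
  exists k y z1 z2, [/\ k <= r, y \in sphere E k x, z1 != z2 &
    [/\ adj E y z1, adj E y z2, z1 \in nball E k x & z2 \in nball E k x]].

(** The last vertex is joined back to the one at index [j]; [j = 0] gives a cycle through the first
    vertex. The bound on [j] leaves at least three vertices in [drop j s], so the closing edge is
    never an edge of the path. *)
Definition lollipop E s j :=
  [&& uniq s, sorted (adj E) s, j.+2 < size s &
      if s is x :: p then adj E (last x p) (nth x s j) else false].

(** Take the least ball containing the cycle. Some vertex of the cycle lies on its boundary sphere,
    and its two neighbours along the cycle are distinct and lie in the ball. *)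
Lemma cycle_branching E r x c : simple_graph E -> 2 < size c -> ucycleb (adj E) c ->
  {subset c <= nball E r x} -> branching E r x.
Proof.
move=> sE sc /andP[cc uc] cB.
have exk : exists k, all (mem (nball E k x)) c by exists r; apply/allP.
case: (ex_minnP exk) => k /allP ckB kmin.
have kr : k <= r by apply: kmin; apply/allP.
have [y yc yS] : exists2 y, y \in c & y \in sphere E k x.
  case: k ckB kmin kr => [|k] ckB kmin kr.
    case: c sc ckB {cc uc cB exk kmin} => // y c _ /(_ y (mem_head _ _)) h.
    by exists y; rewrite ?mem_head.
  have /allPn[y yc yN] : ~~ all (mem (nball E k x)) c.
    by apply/negP => /kmin; rewrite ltnn.
  by exists y; rewrite // inE yN; apply: ckB.
have [i c' def_c] := rot_to yc.
have sc' : 1 < size c' by rewrite -ltnS -[(size c').+1]/(size (y :: c')) -def_c size_rot.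
have := cc; rewrite -(rot_cycle i) def_c => /=.
have := uc; rewrite -(rot_uniq i) def_c => /= /andP[yc' uc'].
have c'B z : z \in c' -> z \in nball E k x.
  by move=> zc; apply: ckB; rewrite -(mem_rot i) def_c inE zc orbT.
case: c' sc' yc' uc' c'B {def_c} => // z1 c' sc' yc' /= /andP[z1c' uc'] c'B.
rewrite rcons_path => /andP[yz1 /andP[_ zy]].
case: c' sc' yc' z1c' uc' c'B zy => //= z c' _ yc' z1c' uc' c'B zy.
exists k, y, z1, (last z c'); split => //.
  by apply: contra z1c' => /eqP ->; apply: mem_last.
split => //; first by rewrite adj_sym.
  by apply: c'B; rewrite mem_head.
by apply: c'B; rewrite in_cons mem_last orbT.
Qed.

Lemma path_ball E k x p : path (adj E) x p -> size p <= k -> {subset x :: p <= nball E k x}.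
Proof.
move=> + + y yp; case/splitPl: p / yp => p1 p2 lp; rewrite cat_path size_cat => /andP[xp _] sp.
by apply/nballP; exists p1; split => //; lia.
Qed.

(* y lies on the sphere, so a path to its neighbour inside the ball cannot visit it earlier. *)
Lemma sphere_upath E k x y z : simple_graph E -> y \in sphere E k x -> adj E y z ->
  z \in nball E k x ->
  exists p, [/\ path (adj E) x p, last x p = z, size p <= k, uniq (x :: p) & y \notin x :: p].
Proof.
move=> sE yS yz /nballP[p0 [xp0 lp0 sp0]].
case/shortenP: xp0 lp0 => p xp up pp0 lp.
have sp : size p <= k.
  by apply: leq_trans sp0; apply: uniq_leq_size pp0; case/andP: up.
exists p; split => //; apply/negP => yp.
case/splitPl: p / yp xp up sp lp {pp0} => p1 p2 lp1 xp _; rewrite size_cat last_cat lp1.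
case: p2 xp => [|w p2] xp sp lp.
  by move: yz; rewrite -[z]lp adj_irrefl.
case: k yS sp {sp0} => [|k] yS sp; first by rewrite addnS in sp.
move: yS; rewrite inE => /andP[/negP[]].
apply/nballP; exists p1; split => //; first by move: xp; rewrite cat_path => /andP[].
by move: sp => /=; lia.
Qed.

(** Walk from [x] to [z1], on to [y], then to [z2] and back towards [x] until the outgoing path is
    met. The two legs have at most [k] vertices each besides [x] and [y], whence the bound
    [r.*2.+1]. *)
Lemma branching_lollipop E r x : simple_graph E -> branching E r x ->
  exists p j, [/\ lollipop E (x :: p) j, size p <= r.*2.+1 & {subset x :: p <= nball E r x}].
Proof.
move=> sE [k [y [z1 [z2 [kr yS z12 [yz1 yz2 z1B z2B]]]]]].
have [p1 [xp1 lp1 sp1 up1 yp1]] := sphere_upath sE yS yz1 z1B.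
have [p2 [xp2 lp2 sp2 up2 yp2]] := sphere_upath sE yS yz2 z2B.
have yq : path (adj E) y (rev (x :: p2)).
  rewrite -(belast_rcons x p2 y) -{1}(last_rcons x p2 y) rev_path.
  under eq_path do rewrite adj_sym.
  by rewrite rcons_path xp2 lp2 adj_sym.
have szq : size (rev (x :: p2)) = (size p2).+1 by rewrite size_rev.
have uq : uniq (rev (x :: p2)) by rewrite rev_uniq.
have hq : head y (rev (x :: p2)) = z2 by rewrite lastI lp2 rev_rcons.
have yNq : y \notin rev (x :: p2) by rewrite mem_rev.
have qB : {subset rev (x :: p2) <= nball E k x}.
  by move=> u; rewrite mem_rev => /(path_ball xp2 sp2).
have hasq : has (mem (x :: p1)) (rev (x :: p2)).
  by apply/hasP; exists x; rewrite /= ?mem_rev mem_head.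
move: (rev _) yq szq uq hq yNq qB hasq => q yq szq uq hq yNq qB hasq.
(* The return path ends at [x], so it meets [x :: p1]; [w] is the first such vertex, and the stretch
   [t] before it is disjoint from the outgoing path. *)
move: yq szq uq hq yNq qB; case: (split_find hasq) => w t q2 wp1 tN yq szq uq hq yNq qB.
have [yt tw] : path (adj E) y t /\ adj E (last y t) w.
  by move: yq; rewrite cat_path rcons_path => /andP[/andP[]].
have szt : size t <= size p2 by rewrite -ltnS -szq size_cat size_rcons addSn ltnS leq_addr.
exists (p1 ++ y :: t), (index w (x :: p1)); split.
- apply/and4P; split.
  + rewrite -cat_cons cat_uniq up1 /= negb_or yp1 /=; apply/andP; split.
      exact: tN.
    move: uq yNq; rewrite cat_uniq rcons_uniq => /andP[/andP[_ ->] _].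
    by rewrite mem_cat mem_rcons !inE !negb_or => /andP[/andP[_ ->]].
  + by rewrite /= cat_path xp1 /= lp1 adj_sym yz1.
  + rewrite /= size_cat /=.
    have : index w (x :: p1) < (size p1).+1 by rewrite -[(size p1).+1]/(size (x :: p1)) index_mem.
    (* If [t] is empty then [w = z2], and [z1 != z2] keeps [w] from being the end of [p1]; otherwise
       [t] itself supplies the third vertex of the cycle. *)
    case: t tN hq {yt tw szt uq yNq qB yq szq} => [|u t] tN /= hq.
      rewrite ltnS leq_eqVlt addn1 ltnS => /orP[/eqP wi|//]; case/negP: z12.
      by rewrite -hq -(nth_index x wp1) -lp1 (last_nth x) /= wi.
    by move: (index _ _) => i; rewrite !ltnS; clear; lia.
  + rewrite -[X in is_true X]/(adj E (last x (p1 ++ y :: t))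
                                    (nth x ((x :: p1) ++ y :: t) (index w (x :: p1)))).
    by rewrite last_cat nth_cat index_mem (wp1 : w \in x :: p1) nth_index.
- by rewrite size_cat -addnn /= addnS ltnS leq_add ?(leq_trans _ kr) ?(leq_trans szt).
- move=> u; rewrite -cat_cons mem_cat => /orP[up|].
    exact: (subsetP (sub_ball E x kr)) (path_ball xp1 sp1 up).
  rewrite inE => /orP[/eqP ->|ut]; apply: (subsetP (sub_ball E x kr)).
    exact: (subsetP (sphere_ball E k x)).
  by apply: qB; rewrite mem_cat mem_rcons inE ut orbT.
Qed.

Lemma lollipop_cycle E s j : lollipop E s j ->
  [/\ 2 < size (drop j s) & ucycleb (adj E) (drop j s)].
Proof.
case: s => // x p /and4P[us ps sj lj]; split; first by rewrite size_drop; lia.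
have js : j < size (x :: p) by lia.
rewrite /ucycleb drop_uniq // andbT (drop_nth x js) /= rcons_path.
move: ps; rewrite -{1}(cat_take_drop j.+1 (x :: p)) (take_nth x js).
have -> : last (nth x (x :: p) j) (drop j.+1 (x :: p)) = last x p.
  rewrite -[last x p]/(last x (x :: p)) -{3}(cat_take_drop j.+1 (x :: p)).
  by rewrite (take_nth x js) last_cat last_rcons.
rewrite lj andbT; case: (take j (x :: p)) => [|u t] //.
by rewrite rcons_cons /= cat_path last_rcons => /andP[].
Qed.
End Balls.

(** * Edge switching *)

Section Switching.

Lemma card_dep_pairs (I J : finType) (A : {set I}) (F : I -> {set J}) :
  #|[set t : I * J | (t.1 \in A) && (t.2 \in F t.1)]| = \sum_(i in A) #|F i|.
Proof.
rewrite -sum1_card; under eq_bigl do rewrite inE.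
under [RHS]eq_bigr do rewrite -sum1_card.
by rewrite pair_big_dep.
Qed.

Lemma in_set2_sum (T : finType) (x a b : T) : a != b ->
  (x \in [set a; b]) = (x == a) + (x == b) :> nat.
Proof. by move=> ab; rewrite !inE; case: eqVneq => // ->; rewrite (negPf ab). Qed.

(** With degrees written as sums over edges, the effect of a switch is a comparison of four
    indicator terms. *)
Lemma deg_sum (T : finType) (E : {set {set T}}) x : simple_graph E ->
  deg E x = \sum_(e in E) (x \in e).
Proof.
move=> /forall_inP sE; rewrite /deg -sum1_card.
rewrite [RHS]big_mkcond /= (eq_bigr (fun e : {set T} => if (e \in E) && (x \in e) then 1 else 0)).
  rewrite -big_mkcond /= sum1_card sum1_card.
  have adjN y : adj E x y -> x != y.
    by apply: contraTneq => <-; apply/negP => /sE; rewrite setUid cards1.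
  rewrite -(card_in_imset (f := fun y => [set x; y])).
    apply: eq_card => e; rewrite [RHS]unfold_in; apply/imsetP/andP.
      by case=> y; rewrite inE => xy ->; rewrite set21.
    case=> eE xe; have /cards2P[a [b [ab def_e]]] := sE e eE.
    move: xe; rewrite def_e !inE => /orP[] /eqP ->.
      by exists b; rewrite // inE /adj -def_e.
    by exists a; rewrite ?inE /adj setUC // -def_e.
  move=> y z; rewrite !inE => xy xz /setP/(_ z); rewrite set22 !inE eq_sym.
  by rewrite (negPf (adjN z xz)) => /eqP.
by move=> e _; case: (e \in E); case: (x \in e).
Qed.

Variables (n d : nat).
Implicit Types (E H F : {set {set 'I_n}}) (a b u v x : 'I_n).

Definition regular_sup H := [set E in regular_graphs n d | H \subset E].

Definition switch u v a b E := 
  [set u; a] |: ([set v; b] |: ((E :\ [set u; v]) :\ [set a; b])).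

Definition switchable u v E a b :=
  [&& adj E a b, a \notin [set u; v], b \notin [set u; v], ~~ adj E u a & ~~ adj E v b].

Lemma set2_inj u v a b : u != a -> u != b -> [set u; v] != [set a; b].
Proof.
move=> ua ub; apply/eqP => /setP/(_ u).
by rewrite set21 !inE (negPf ua) (negPf ub).
Qed.

Lemma switchable_neq u v E a b : simple_graph E -> switchable u v E a b ->
  [/\ u != a, u != b, v != a, v != b & a != b].
Proof.
move=> sE /and5P[ab]; rewrite !inE !negb_or !(eq_sym a) !(eq_sym b).
case/andP=> ua va /andP[ub vb] _ _; split => //.
by apply: contraTneq ab => ->; rewrite adj_irrefl.
Qed.

Lemma switch_regular u v E a b : u != v -> adj E u v -> switchable u v E a b ->
  E \in regular_graphs n d -> switch u v a b E \in regular_graphs n d.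
Proof.
move=> uv Euv sw; rewrite !inE => /andP[sE /forallP degE].
have [ua ub va vb ab] := switchable_neq sE sw.
have /and5P[Eab _ _ Nua Nvb] := sw.
have sE' : simple_graph (switch u v a b E).
  apply/forall_inP => e; rewrite !inE => /or3P[/eqP->|/eqP->|/and3P[_ _]].
  - by rewrite cards2 ua.
  - by rewrite cards2 vb.
  - exact: (forall_inP sE).
rewrite sE'; apply/forallP => x; rewrite -(eqP (degE x)) !deg_sum //.
rewrite /switch big_setU1; last first.
  by rewrite !inE !negb_or set2_inj //= (negPf (Nua : [set u; a] \notin E)) !andbF.
rewrite big_setU1; last by rewrite !inE (negPf (Nvb : [set v; b] \notin E)) !andbF.
apply/eqP; rewrite [RHS](big_setD1 [set u; v]) //= [X in _ = _ + X](big_setD1 [set a; b]) /=; last first.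
  by rewrite !inE eq_sym set2_inj.
by rewrite !in_set2_sum // !addnA (addnAC (x == u : nat)).
Qed.

(** The reverse switch restores the graph, so for fixed [u], [v], [a], [b] switching is
    injective. *)
Lemma switchK u v E a b : simple_graph E -> u != v -> adj E u v -> switchable u v E a b ->
  [set u; v] |: ([set a; b] |: ((switch u v a b E :\ [set u; a]) :\ [set v; b])) = E.
Proof.
move=> sE uv Euv sw; have [ua ub va vb ab] := switchable_neq sE sw.
have /and5P[Eab _ _ Nua Nvb] := sw.
apply/setP => e; rewrite !inE.
case: (eqVneq e [set u; v]) => [->|_] /=; first by rewrite -[LHS]Euv.
case: (eqVneq e [set a; b]) => [->|_] /=; first by rewrite -[LHS]Eab.
case: (eqVneq e [set u; a]) => [->|_] /=; first by rewrite (negPf (Nua : [set u; a] \notin E)) andbF.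
by case: (eqVneq e [set v; b]) => [->|_] //=; rewrite (negPf (Nvb : [set v; b] \notin E)).
Qed.

Lemma card_adj_fst E (S : {set 'I_n}) : (forall x, deg E x = d) ->
  #|[set t | (t.1 \in S) && adj E t.1 t.2]| = #|S| * d.
Proof.
move=> degE; transitivity #|[set t | (t.1 \in S) && (t.2 \in [set y | adj E t.1 y])]|.
  by apply: eq_card => t; rewrite !inE.
rewrite (card_dep_pairs S (fun x => [set y | adj E x y])).
by rewrite -sum_nat_const; apply: eq_bigr => x _; apply: degE.
Qed.

Lemma card_adj_snd E (S : {set 'I_n}) : (forall x, deg E x = d) ->
  #|[set t | (t.2 \in S) && adj E t.1 t.2]| = #|S| * d.
Proof.
move=> degE; rewrite -(card_adj_fst S degE).
rewrite -(card_imset _ (f := fun t => (t.2, t.1))); last by move=> [? ?] [? ?] [-> ->].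
apply: eq_card => t; rewrite inE; apply/imsetP/idP.
  by case=> s; rewrite inE adj_sym => + ->.
by move=> h; exists (t.2, t.1); rewrite ?inE ?[adj E t.2 t.1]adj_sym //; case: t {h}.
Qed.

Lemma card_pairs_in H : (forall e, e \in H -> #|e| = 2) ->
  #|[set t : 'I_n * 'I_n | [set t.1; t.2] \in H]| <= #|H| * 2.
Proof.
move=> H2; have -> : [set t : 'I_n * 'I_n | [set t.1; t.2] \in H] =
    \bigcup_(e in H) [set t | [set t.1; t.2] == e].
  apply/setP => t; rewrite inE; apply/idP/bigcupP; last by case=> e eH; rewrite inE => /eqP->.
  by move=> h; exists [set t.1; t.2]; rewrite ?inE.
apply: card_bigcup_le => e /H2 /eqP/cards2P[a [b [ab ->]]].
apply: (@leq_trans #|[set (a, b); (b, a)]|); last by rewrite cards2; case: eqP.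
apply/subset_leq_card/subsetP => -[x y]; rewrite !inE /= => /eqP/setP s.
have := s x; have := s y; have := s a; have := s b; rewrite !inE !eqxx !orbT !xpair_eqE /=.
rewrite !(eq_sym a) !(eq_sym b).
by case: (x =P a) => [->|_] /=; case: (y =P b) => [->|_] //=; rewrite ?(negPf ab) ?orbF //=;
   case: (x == b); case: (y == a).
Qed.

(** Of the [n * d] ordered adjacent pairs, at most [2 * #|H|] are edges of [H], and at most
    [(2 + d) * d] are lost to the conditions on [a], and as many to those on [b]. The size
    hypothesis says that these losses are at most half of the pairs. *)
Lemma card_switchable E H u v : E \in regular_sup H ->
  4 * #|H| + 8 * d + 4 * d ^ 2 <= n * d ->
  n * d <= #|[set t | switchable u v E t.1 t.2 && ([set t.1; t.2] \notin H)]| * 2.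
Proof.
rewrite !inE => /andP[/andP[sE /forallP dE] HE] nd.
have degE x : deg E x = d by apply/eqP.
set G := [set t | _].
pose S w := [set u; v] :|: [set y | adj E w y].
have cS w : #|S w| <= 2 + d.
  apply: leq_trans (leq_card_setU _ _) _; rewrite leq_add //.
    by rewrite cards2; case: eqP.
  by rewrite -/(deg E w) degE.
pose B := [set t : 'I_n * 'I_n | [set t.1; t.2] \in H].
have cB : #|B| <= #|H| * 2.
  by apply: card_pairs_in => e /(subsetP HE) /(forall_inP sE) /eqP.
have cover : [set t | (t.1 \in [set: 'I_n]) && adj E t.1 t.2] \subset
   G :|: (B :|: ([set t | (t.1 \in S u) && adj E t.1 t.2] :|:
               [set t | (t.2 \in S v) && adj E t.1 t.2])).
  apply/subsetP => -[a b]; rewrite !inE /= => Eab; rewrite /switchable Eab /= !inE.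
  by case: (_ \in H); case: (a == u); case: (a == v); case: (b == u); case: (b == v);
     case: (adj E u a); case: (adj E v b).
have := subset_leq_card cover; rewrite card_adj_fst // cardsT card_ord => le1.
have le2 : n * d <= #|G| + (#|H| * 2 + ((2 + d) * d + (2 + d) * d)).
  apply: leq_trans le1 _; apply: leq_trans (leq_card_setU _ _) _; rewrite leq_add2l.
  apply: leq_trans (leq_card_setU _ _) _; apply: leq_add => //.
  apply: leq_trans (leq_card_setU _ _) _.
  by rewrite card_adj_fst // card_adj_snd // leq_add // leq_mul2r cS orbT.
have -> : #|G| * 2 = #|G| + #|G| by lia.
clear -le2 nd; move: #|G| #|H| le2 nd => g h; nia.
Qed.

(* The map (E, a, b) |-> (switch u v a b E, a, b) is injective; it has at least nd/2 pairs (a, b) for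
   each E, and its values satisfy a ~ u and b ~ v, which leaves at most d^2 pairs (a, b). *)
Lemma regular_sup_switch H u v : u != v -> [set u; v] \notin H -> 0 < d ->
  4 * #|H| + 8 * d + 4 * d ^ 2 <= n * d ->
  #|regular_sup ([set u; v] |: H)| * n <= 2 * d * #|regular_sup H|.
Proof.
move=> uv uvH d0 nd.
pose good E := [set t : 'I_n * 'I_n | switchable u v E t.1 t.2 && ([set t.1; t.2] \notin H)].
pose X := [set p : {set {set 'I_n}} * ('I_n * 'I_n) |
             (p.1 \in regular_sup ([set u; v] |: H)) && (p.2 \in good p.1)].
pose Y := [set p : {set {set 'I_n}} * ('I_n * 'I_n) |
             (p.1 \in regular_sup H) && (p.2 \in setX [set y | adj p.1 u y] [set y | adj p.1 v y])].
have supP E : E \in regular_sup ([set u; v] |: H) ->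
    [/\ simple_graph E, E \in regular_graphs n d, adj E u v & H \subset E].
  rewrite !inE subUset sub1set => /and3P[/andP[sE dE] Euv HE].
  by rewrite /= sE dE.
have cX : #|regular_sup ([set u; v] |: H)| * (n * d) <= #|X| * 2.
  rewrite (card_dep_pairs _ good) big_distrl /= -sum_nat_const; apply: leq_sum => E EA.
  apply: card_switchable nd; have [_ h _ HE] := supP E EA.
  by rewrite inE h.
have cY : #|Y| = #|regular_sup H| * (d * d).
  rewrite (card_dep_pairs _ (fun E => setX [set y | adj E u y] [set y | adj E v y])).
  rewrite -sum_nat_const; apply: eq_bigr => E.
  by rewrite cardsX !inE => /andP[/andP[_ /forallP dE] _]; rewrite -!/(deg E _) !(eqP (dE _)).
have XY : #|X| <= #|Y|.
  pose f (p : {set {set 'I_n}} * ('I_n * 'I_n)) := (switch u v p.2.1 p.2.2 p.1, p.2).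
  rewrite -(card_in_imset (f := f)).
    apply/subset_leq_card/subsetP => q /imsetP[[E [a b]]]; rewrite inE /= => /andP[/supP].
    case=> sE rE Euv HE; rewrite /good inE /= => /andP[sw abH] ->.
    rewrite inE /=; apply/andP; split; last by rewrite in_setX !inE /adj /switch !inE !eqxx /= orbT.
    rewrite in_set (switch_regular uv Euv sw rE) /=.
    (* Neither deleted edge belongs to [H], so the switched graph still contains [H]. *)
    apply/subsetP => e eH; rewrite !inE (subsetP HE) // andbT.
    apply/orP; right; apply/orP; right; apply/andP.
    by split; [apply: contraNneq abH => <-|apply: contraNneq uvH => <-].
  move=> [E [a b]] [E' [a' b']]; rewrite !inE /=.
  move=> /andP[+ /andP[sw _]] /andP[+ /andP[sw' _]] => h h' [eqE ea eb].
  rewrite -{}ea -{}eb in sw' eqE *; congr (_, _).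
  have [sE _ Euv _] : [/\ simple_graph E, E \in regular_graphs n d, adj E u v & H \subset E].
    by apply: supP; rewrite !inE.
  have [sE' _ Euv' _] : [/\ simple_graph E', E' \in regular_graphs n d, adj E' u v & H \subset E'].
    by apply: supP; rewrite !inE.
  by rewrite -(switchK sE uv Euv sw) eqE (switchK sE' uv Euv' sw').
have := leq_trans cX (leq_mul XY (leqnn 2)); rewrite cY.
set A := #|_|; set D := #|_| => h.
have : d * (A * n) <= d * (2 * d * D) by clear -h; lia.
by rewrite leq_pmul2l.
Qed.
End Switching.

(** * Counting lollipops *)

Section LollipopEdges.
Variable T : finType.
Implicit Types (E : {set {set T}}) (x y z : T) (p : seq T) (e : {set T}).

Fixpoint path_edges x p :=
  if p is y :: p' then [set x; y] :: path_edges y p' else [::].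

Definition lollipop_edges x p j : {set {set T}} :=
  [set last x p; nth x (x :: p) j] |: [set e in path_edges x p].

Lemma path_edges_rcons x p y :
  path_edges x (rcons p y) = rcons (path_edges x p) [set last x p; y].
Proof. by elim: p x => //= z p IH x; rewrite IH. Qed.

Lemma size_path_edges x p : size (path_edges x p) = size p.
Proof. by elim: p x => //= y p IH x; rewrite IH. Qed.

Lemma path_edges_sub x p e z : e \in path_edges x p -> z \in e -> z \in x :: p.
Proof.
elim: p x => //= y p IH x; rewrite !inE => /orP[/eqP ->|/IH h /h].
  by rewrite !inE => /orP[] ->; rewrite ?orbT.
by rewrite inE => ->; rewrite orbT.
Qed.

Lemma path_edges_uniq x p : uniq (x :: p) -> uniq (path_edges x p).
Proof.
elim: p x => //= y p IH x /andP[xp up]; rewrite IH // andbT.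
by apply: contra xp => /path_edges_sub; apply; rewrite set21.
Qed.

Lemma path_edges_path E x p : path (adj E) x p -> {subset path_edges x p <= E}.
Proof.
elim: p x => //= y p IH x /andP[xy yp] e; rewrite inE => /orP[/eqP ->|] //.
exact: IH.
Qed.

Lemma path_edges_card x p e : uniq (x :: p) -> e \in path_edges x p -> #|e| = 2.
Proof.
elim: p x => //= y p IH x /andP[]; rewrite !inE negb_or => /andP[xy _] up /orP[/eqP->|].
  by rewrite cards2 xy.
exact: IH.
Qed.

(** The only path edge at the last vertex is the final one, and its other end comes strictly after
    index [j]. *)
Lemma lollipop_closing x p j : uniq (x :: p) -> j.+1 < size p ->
  (last x p != nth x (x :: p) j) /\ [set last x p; nth x (x :: p) j] \notin path_edges x p.
Proof.
case/lastP: p => // p y up; rewrite size_rcons ltnS last_rcons => jp.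
have -> : nth x (x :: rcons p y) j = nth x (x :: p) j.
  by rewrite -rcons_cons nth_rcons /= ltnW.
move: up; rewrite -rcons_cons rcons_uniq => /andP[yp up].
have zp : nth x (x :: p) j \in x :: p by rewrite mem_nth //= ltnW.
have yz : y != nth x (x :: p) j by apply: contraNneq yp => ->.
split=> //; rewrite path_edges_rcons mem_rcons inE negb_or; apply/andP; split; last first.
  by apply: contra yp => /path_edges_sub; apply; rewrite set21.
apply: contraTneq jp => /setP/(_ (nth x (x :: p) j)); rewrite set22 !inE.
rewrite [_ == y]eq_sym (negPf yz) orbF (last_nth x) => /esym/eqP h.
apply/negP => jp'.
have := nth_uniq x (leqW jp' : j < size (x :: p)) (leqnn _ : size p < size (x :: p)) up.
by rewrite h eqxx => /esym/eqP je; rewrite je ltnn in jp'.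
Qed.

(** A path has one edge fewer than vertices; the closing edge makes up for it. This extra edge is
    what later yields the factor [1/n] for a lollipop at a given vertex. *)
Lemma card_lollipop_edges x p j : uniq (x :: p) -> j.+1 < size p ->
  #|lollipop_edges x p j| = (size p).+1.
Proof.
move=> up jp; have [_ cN] := lollipop_closing up jp.
rewrite /lollipop_edges cardsU1 inE cN add1n cardsE.
by rewrite (card_uniqP (path_edges_uniq up)) size_path_edges.
Qed.

Lemma lollipop_edges_card x p j e : uniq (x :: p) -> j.+1 < size p ->
  e \in lollipop_edges x p j -> #|e| = 2.
Proof.
move=> up jp; have [zN _] := lollipop_closing up jp.
rewrite !inE => /orP[/eqP ->|]; first by rewrite cards2 zN.
exact: path_edges_card.
Qed.

Lemma lollipop_edges_sub x p j e : j.+1 < size p ->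
  e \in lollipop_edges x p j -> e \subset [set z in x :: p].
Proof.
move=> jp; rewrite !inE => eL; apply/subsetP => z ze; rewrite inE.
case/orP: eL ze => [/eqP ->|h]; last exact: path_edges_sub.
case/set2P=> ->; first exact: mem_last.
by rewrite mem_nth //=; lia.
Qed.

Lemma lollipop_edgesE E x p j : lollipop E (x :: p) j -> lollipop_edges x p j \subset E.
Proof.
case/and4P=> _ xp _ lj; apply/subsetP => e; rewrite !inE => /orP[/eqP->|] //.
exact: path_edges_path.
Qed.

Lemma nball_sym E k x y : y \in nball E k x -> x \in nball E k y.
Proof.
case/nballP=> p [xp <- sp]; apply/nballP; exists (rev (belast x p)).
rewrite size_rev size_belast; split=> //.
  by rewrite rev_path; under eq_path do rewrite adj_sym.
by case: p {xp sp} => //= y' p; rewrite rev_cons last_rcons.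
Qed.
End LollipopEdges.

(** * Expected numbers of lollipops and of disjoint families of them *)

Section Counting.
Variables (R : realFieldType) (n d K : nat).
Implicit Types (E H F : {set {set 'I_n}}) (W : {set 'I_n}) (x : 'I_n).
Local Open Scope ring_scope.

Local Notation w := ((2 * d)%:R / n%:R : R).

Lemma size_gt0 a : (0 < d)%N -> (a + 8 * d + 4 * d ^ 2 <= n * d)%N -> (0 < n)%N.
Proof. by case: (posnP n) => // ->; rewrite mul0n; lia. Qed.

(** The edges of [F] are added to [H] one at a time; each costs a factor [w] by switching, and the
    size hypothesis covers every intermediate edge set. *)
Lemma card_regular_sup H F : (0 < d)%N -> (forall e, e \in F -> #|e| = 2%N) ->
  [disjoint F & H] -> (4 * (#|H| + #|F|) + 8 * d + 4 * d ^ 2 <= n * d)%N ->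
  #|regular_sup d (F :|: H)|%:R <= w ^+ #|F| * #|regular_sup d H|%:R.
Proof.
move=> d0; move: {2}#|F| (erefl #|F|) => m; elim: m F => [|m IH] F cF F2 FH nd.
  by move/eqP: cF; rewrite cards_eq0 => /eqP ->; rewrite set0U cards0 expr0 mul1r.
have [e eF] : exists e, e \in F by apply/set0Pn; rewrite -cards_eq0 cF.
have cF' : #|F :\ e| = m by have := cardsD1 e F; rewrite eF cF => -[].
have n0 := size_gt0 d0 nd.
have F'H : [disjoint F :\ e & H] by apply: disjointWl FH; rewrite subD1set.
have := IH _ cF' (fun e' h => F2 e' (subsetP (subD1set F e) _ h)) F'H.
have /[swap]/[apply] IH' : (4 * (#|H| + #|F :\ e|) + 8 * d + 4 * d ^ 2 <= n * d)%N by lia.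
have /eqP/cards2P[u [v [uv def_e]]] := F2 e eF.
have eN : e \notin (F :\ e) :|: H.
  by rewrite !inE eqxx /= (disjointFr FH eF).
have := @regular_sup_switch n d ((F :\ e) :|: H) u v uv; rewrite -def_e => /(_ eN d0).
have -> : e |: (F :\ e :|: H) = F :|: H by rewrite setUA setD1K.
have cU : (#|F :\ e :|: H| <= m + #|H|)%N by rewrite -cF' leq_card_setU.
have /[swap]/[apply] : (4 * #|(F :\ e) :|: H| + 8 * d + 4 * d ^ 2 <= n * d)%N by lia.
rewrite -(ler_nat R) natrM [X in _ <= X]natrM => h.
have n0' : (0 : R) < n%:R by rewrite ltr0n.
rewrite cF exprS -mulrA; apply: (@le_trans _ _ (w * #|regular_sup d (F :\ e :|: H)|%:R)).
  by rewrite mulrAC ler_pdivlMr.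
by rewrite ler_wpM2l ?divr_ge0 // -cF'.
Qed.

(* A lollipop is coded by its first vertex, its other vertices, and the index of the vertex to
   which the last one is joined back. *)
Definition tail_code := {k : 'I_K & (k.-tuple 'I_n * 'I_K)%type}.

Definition code_verts (c : 'I_n * tail_code) := [set z in c.1 :: (tagged c.2).1].
Definition code_edges (c : 'I_n * tail_code) :=
  lollipop_edges c.1 (tagged c.2).1 (tagged c.2).2.
Definition code_ok (c : 'I_n * tail_code) :=
  uniq (c.1 :: (tagged c.2).1) && ((tagged c.2).2.+1 < tag c.2)%N.

(** One factor [K] is for the tail length and one for the attaching index; [(2d)^K] dominates the
    powers of [2d] coming from the edges. *)
Definition code_weight : R := K%:R ^+ 2 * (2 * d)%:R ^+ K.

(** A tail of [k] vertices can be chosen in [n^k] ways but costs [k + 1] edge factors, so exactly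
    one [1/n] survives. *)
Lemma sum_tail_code : (0 < n)%N -> (0 < d)%N ->
  \sum_(c : tail_code) w ^+ (tag c).+1 <= code_weight / n%:R.
Proof.
move=> n0 d0; have n0' : (n%:R : R) != 0 by rewrite pnatr_eq0 -lt0n.
have -> : \sum_(c : tail_code) w ^+ (tag c).+1 =
    \sum_(k < K) \sum_(t : (k.-tuple 'I_n * 'I_K)%type) w ^+ k.+1.
  by rewrite (sig_big_dep (J := fun k : 'I_K => (k.-tuple 'I_n * 'I_K)%type)
      predT (fun _ => predT) (fun (k : 'I_K) _ => w ^+ k.+1)).
have -> : code_weight / n%:R = \sum_(k < K) (K%:R * (2 * d)%:R ^+ K / n%:R).
  by rewrite sumr_const card_ord -[RHS]mulr_natl /code_weight expr2 !mulrA.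
apply: ler_sum => k _; rewrite sumr_const card_prod card_tuple !card_ord.
rewrite -[leLHS]mulr_natl natrM natrX exprS expr_div_n.
have -> : n%:R ^+ k * K%:R * ((2 * d)%:R / n%:R * ((2 * d)%:R ^+ k / n%:R ^+ k)) =
    K%:R * ((2 * d)%:R ^+ k.+1) / n%:R :> R.
  rewrite exprS; field; rewrite n0' expf_neq0 //.
rewrite ler_wpM2r ?invr_ge0 // ler_wpM2l // ler_weXn2l //.
by rewrite ler1n; lia.
Qed.

Lemma code_okP E x p j : lollipop E (x :: p) j -> (size p < K)%N ->
  exists c, [/\ code_ok c, c.1 = x, code_verts c = [set z in x :: p] &
                code_edges c \subset E].
Proof.
move=> lol sp; have /and4P[up _ jp _] := lol; rewrite /= ltnS in jp.
have jK : (j < K)%N by apply: ltn_trans sp; apply: ltnW.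
exists (x, Tagged (fun k : 'I_K => (k.-tuple 'I_n * 'I_K)%type) (i := Ordinal sp) (in_tuple p, Ordinal jK)).
split=> //; first by apply/andP; split.
exact: lollipop_edgesE.
Qed.

Lemma card_code_edges c : code_ok c -> #|code_edges c| = (tag c.2).+1.
Proof. by case/andP=> u j; rewrite card_lollipop_edges // size_tuple. Qed.

Lemma code_edges2 c e : code_ok c -> e \in code_edges c -> #|e| = 2%N.
Proof. by case/andP=> u j; apply: lollipop_edges_card; rewrite // size_tuple. Qed.

Lemma code_edges_sub c e : code_ok c -> e \in code_edges c -> e \subset code_verts c.
Proof. by case/andP=> u j; apply: lollipop_edges_sub; rewrite // size_tuple. Qed.

Lemma card_code_verts c : (#|code_verts c| <= K)%N.
Proof.
rewrite cardsE; apply: leq_trans (card_size _) _.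
by rewrite /= size_tuple.
Qed.

(** Union bound over the lollipops at [x], each estimated by [card_regular_sup] with nothing
    prescribed beforehand. *)
Lemma has_code_rooted x : (0 < d)%N -> (4 * K + 8 * d + 4 * d ^ 2 <= n * d)%N ->
  #|[set E in regular_graphs n d |
      [exists c, [&& code_ok (x, c) & code_edges (x, c) \subset E]]]|%:R <=
  code_weight / n%:R * #|regular_graphs n d|%:R :> R.
Proof.
move=> d0 nd; have n0 := size_gt0 d0 nd.
apply: (@le_trans _ _ (\sum_(c | code_ok (x, c)) #|regular_sup d (code_edges (x, c))|%:R)).
  rewrite -natr_sum ler_nat.
  apply: leq_trans (leq_card_bigcup _ _).
  apply/subset_leq_card/subsetP => E; rewrite inE => /andP[rE /existsP[c /andP[ok cE]]].
  by apply/bigcupP; exists c; rewrite // inE rE.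
apply: (@le_trans _ _ (\sum_(c | code_ok (x, c)) w ^+ (tag c).+1 * #|regular_graphs n d|%:R)).
  apply: ler_sum => c ok; have := @card_regular_sup set0 (code_edges (x, c)) d0.
  rewrite card_code_edges // setU0 cards0 add0n => h.
  have -> : regular_graphs n d = regular_sup d set0.
    by apply/setP => E; rewrite [RHS]inE sub0set andbT.
  apply: h; first by move=> e; apply: code_edges2.
    by rewrite -setI_eq0 setI0.
  by have := ltn_ord (tag c); move: nd => /=; move: (n * d)%N (d ^ 2)%N => a b; lia.
rewrite -mulr_suml ler_wpM2r //; apply: le_trans (sum_tail_code n0 d0).
rewrite [leRHS](bigID (fun c => code_ok (x, c))) /= lerDl.
by apply: sumr_ge0 => c _; rewrite exprn_ge0 // divr_ge0.
Qed.

(* The number of m-tuples of lollipops of E, vertex-disjoint from each other and from W. *)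
Fixpoint chains m E W : nat :=
  if m is m'.+1 then
    \sum_(c | [&& code_ok c, code_edges c \subset E & [disjoint code_verts c & W]])
      chains m' E (W :|: code_verts c)
  else 1.

(** Induction on [m]: after exchanging the sums, the first lollipop of the chain is absorbed into
    the prescribed set [H] and its vertices into [W]. *)
Lemma sum_chains m H W : (0 < d)%N ->
  (forall e, e \in H -> e \subset W) ->
  (4 * (#|H| + m * K) + 8 * d + 4 * d ^ 2 <= n * d)%N ->
  \sum_(E in regular_sup d H) (chains m E W)%:R <=
    code_weight ^+ m * #|regular_sup d H|%:R :> R.
Proof.
move=> d0; elim: m H W => [|m IH] H W HW nd.
  by rewrite expr0 mul1r sumr_const.
have n0 := size_gt0 d0 nd.
have cX0 : 0 <= code_weight by rewrite mulr_ge0 // exprn_ge0.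
under eq_bigr do rewrite /= natr_sum.
rewrite (exchange_big_dep (fun c => code_ok c && [disjoint code_verts c & W])) /=; last first.
  by move=> E c _ /and3P[-> _ ->].
apply: (@le_trans _ _ (\sum_(c | code_ok c && [disjoint code_verts c & W])
    w ^+ (tag c.2).+1 * (code_weight ^+ m * #|regular_sup d H|%:R))); last first.
  rewrite -mulr_suml exprS -mulrA ler_wpM2r ?mulr_ge0 ?exprn_ge0 //.
  apply: (@le_trans _ _ (\sum_(c : 'I_n * tail_code) w ^+ (tag c.2).+1)).
    rewrite [leRHS](bigID (fun c => code_ok c && [disjoint code_verts c & W])) /= lerDl.
    by apply: sumr_ge0 => c _; rewrite exprn_ge0 // divr_ge0.
  (* The [n] choices of the first vertex cancel the [1/n] of [sum_tail_code]. *)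
  rewrite -(pair_bigA _ (fun (_ : 'I_n) (c : tail_code) => w ^+ (tag c).+1)) /=.
  rewrite sumr_const card_ord -[leLHS]mulr_natl.
  apply: le_trans (ler_wpM2l (ler0n _ _) (sum_tail_code n0 d0)) _.
  by rewrite mulrC divfK // pnatr_eq0 -lt0n.
apply: ler_sum => c /andP[ok cW].
(* A common edge would have its ends both in [W] and among the vertices of [c], which are
   disjoint. *)
have cH : [disjoint code_edges c & H].
  rewrite -setI_eq0; apply/eqP/setP => e; rewrite in_setI in_set0; apply/negP => /andP[ec /HW eW].
  have /eqP/cards2P[a [b [_ def_e]]] := code_edges2 ok ec.
  have ae : a \in e by rewrite def_e set21.
  have := subsetP (code_edges_sub ok ec) _ ae; have := subsetP eW _ ae.
  by move=> aW; rewrite (disjointFl cW aW).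
have cK := ltn_ord (tag c.2); have cE := card_code_edges ok.
have nd' : (4 * (#|H| + #|code_edges c| + m * K) + 8 * d + 4 * d ^ 2 <= n * d)%N.
  apply: leq_trans nd; rewrite !leq_add2r leq_mul2l /= mulSn cE.
  by clear -cK; move: (m * K)%N (nat_of_ord _) cK => a b; lia.
have -> : \sum_(E in regular_sup d H | [&& code_ok c, code_edges c \subset E & [disjoint code_verts c & W]])
     (chains m E (W :|: code_verts c))%:R =
   \sum_(E in regular_sup d (code_edges c :|: H)) (chains m E (W :|: code_verts c))%:R :> R.
  apply: eq_bigl => E; rewrite /regular_sup !in_set ok cW /= andbT.
  by rewrite [in RHS]subUset -!andbA; do 2!congr (_ && _); rewrite andbC.
apply: le_trans (IH _ _ _ _) _.
- move=> e; rewrite in_setU => /orP[/(code_edges_sub ok)|/HW] h; apply: subset_trans h _.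
    exact: subsetUr.
  exact: subsetUl.
- apply: leq_trans nd'; rewrite !leq_add2r leq_mul2l /=.
  by rewrite leq_add2r addnC leq_card_setU.
rewrite [leRHS]mulrCA ler_wpM2l ?exprn_ge0 // -cE; apply: card_regular_sup => //.
  by move=> e; apply: code_edges2.
apply: leq_trans nd'; rewrite !leq_add2r leq_mul2l /=; exact: leq_addr.
Qed.

(** Greedy choice: a root farther than [K] from [W] has its lollipop disjoint from [W], and [W]
    rules out at most [#|W| * d.+1 ^ K] roots. Each step enlarges [W] by at most [K] vertices, so
    [b] roots remain at every one of the [m] steps. *)
Lemma chains_lower m E W (B : {set 'I_n}) b :
  E \in regular_graphs n d ->
  (forall x, x \in B -> exists p j, lollipop E (x :: p) j /\ (size p < K)%N) ->
  (b + (#|W| + m * K) * d.+1 ^ K <= #|B|)%N -> (b ^ m <= chains m E W)%N.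
Proof.
move=> rE BL; elim: m W => [|m IH] W bB //.
have degE y : (deg E y <= d)%N.
  by move: rE; rewrite inE => /andP[_ /forallP/(_ y)/eqP->].
pose G := [set c | [&& code_ok c, code_edges c \subset E & [disjoint code_verts c & W]]].
have cG : (b <= #|G|)%N.
  pose B' := B :\: \bigcup_(z in W) nball E K z.
  have cB' : (b <= #|B'|)%N.
    rewrite cardsD -(leq_add2r #|B :&: \bigcup_(z in W) nball E K z|).
    rewrite subnK ?subset_leq_card ?subsetIl //; apply: leq_trans bB; rewrite leq_add2l.
    apply: leq_trans (subset_leq_card (subsetIr _ _)) _.
    apply: (@leq_trans (#|W| * d.+1 ^ K)); last by rewrite leq_mul2r leq_addr orbT.
    by apply: card_bigcup_le => z _; apply: card_ball.
  apply: leq_trans cB' _; apply: leq_trans (leq_imset_card fst (mem G)).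
  apply/subset_leq_card/subsetP => x; rewrite inE => /andP[xW /BL[p [j [lol sp]]]].
  have [c [ok cx cp cE]] := code_okP lol sp.
  apply/imsetP; exists c => //; rewrite inE ok cE /=.
  rewrite -setI_eq0; apply/eqP/setP => z; rewrite in_set0; apply/negP.
  rewrite in_setI cp inE => /andP[zp zW]; case/negP: xW; apply/bigcupP; exists z => //.
  apply: nball_sym; have /and4P[_ xp _ _] := lol.
  exact: (path_ball xp (ltnW sp) zp).
rewrite expnS; apply: (@leq_trans (\sum_(c in G) b ^ m)).
  by rewrite sum_nat_const leq_mul2r cG orbT.
rewrite /= [leqRHS](eq_bigl (fun c => c \in G)); last by move=> c; rewrite inE.
apply: leq_sum => c; rewrite inE => /and3P[ok cE cW].
apply: IH; apply: leq_trans bB; rewrite leq_add2l leq_mul2r mulSn addnA; apply/orP; right.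
rewrite leq_add2r; apply: leq_trans (leq_card_setU _ _) _.
by rewrite leq_add2l card_code_verts.
Qed.
End Counting.

(** * Eigenvectors on tree-like neighbourhoods *)

Section TreeSpheres.
Variables (T : finType) (E : {set {set T}}) (d r : nat) (x : T).
Hypotheses (sE : simple_graph E) (degE : forall y, deg E y = d).
Hypothesis treeE : ~ branching E r x.

Let nb k z := #|[set y | adj E z y] :&: nball E k x|.

Lemma nb_in k z : z \in nball E k x -> nb k.+1 z = d.
Proof.
move=> zB; rewrite -(degE z); apply: eq_card => y; rewrite in_setI inE [RHS]inE.
by case zy: (adj E z y) => //=; rewrite (nball_adj zB zy).
Qed.

Lemma nb_out k z : z \notin nball E k.+1 x -> nb k z = 0.
Proof.
move=> zB; apply/eqP; rewrite cards_eq0; apply/eqP/setP => y; rewrite in_setI in_set0 inE.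
apply/negP => /andP[zy yB]; case/negP: zB; apply: nball_adj yB _; by rewrite adj_sym.
Qed.

Lemma nb_le1 k z : k <= r -> z \in sphere E k x -> nb k z <= 1.
Proof.
move=> kr zS; apply/card_le1P => y1; rewrite in_setI inE => /andP[zy1 y1B] y2.
rewrite [in LHS]in_setI inE [RHS]inE; apply/andP/eqP => [[zy2 y2B]|->] //.
apply/eqP; case: eqVneq => // y21; case: treeE; exists k, z, y2, y1.
by split.
Qed.

Lemma nb_ge1 k z : z \in sphere E k.+1 x -> 0 < nb k z.
Proof.
rewrite in_setD => /andP[zN]; rewrite in_setU (negPf zN) inE => /existsP[y /andP[yB yz]].
by apply/card_gt0P; exists y; rewrite in_setI inE adj_sym yz.
Qed.

Lemma nb_mono k z : nb k z <= nb k.+1 z.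
Proof. by apply: subset_leq_card; apply: setIS; apply: nballS. Qed.

(** In a tree a vertex off the root has one parent and no neighbour on its own level. *)
Lemma nb_sphere k z : k.+1 <= r -> z \in sphere E k.+1 x -> nb k z = 1 /\ nb k.+1 z = 1.
Proof.
move=> kr zS; have := nb_le1 kr zS; have := nb_ge1 zS; have := nb_mono k z.
by move: (nb k z) (nb k.+1 z) => a b; lia.
Qed.

Lemma nb_root : nb 0 x = 0.
Proof.
apply/eqP; rewrite cards_eq0; apply/eqP/setP => y; rewrite in_setI in_set0 inE.
by apply/negP => /andP[/[swap]]; rewrite inE => /eqP ->; rewrite adj_irrefl.
Qed.

(** The count is [nb k.+1 z - nb k z], read off level by level: a vertex two levels out has one
    parent there, a vertex of level [k] has all its neighbours there but its own parent, and all
    others have none. The term [0 < k] reflects that the root has no parent. *)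
Lemma card_nbhd_sphere k z : k.+2 <= r ->
  #|[set y | adj E z y] :&: sphere E k.+1 x| =
    (z \in sphere E k.+2 x) + (z \in sphere E k x) * (d - (0 < k)).
Proof.
move=> kr.
have -> : #|[set y | adj E z y] :&: sphere E k.+1 x| = nb k.+1 z - nb k z.
  by rewrite setIDA cardsD -setIA (setIidPr (nballS E k x)).
have sph l : z \in sphere E l.+1 x = (z \notin nball E l x) && (z \in nball E l.+1 x).
  by rewrite [LHS]in_setD.
have sB l u : z \in nball E l x -> l <= u -> z \in nball E u x.
  by move=> + lu; apply: (subsetP (sub_ball E x lu)).
have s2 : z \in nball E k x -> (z \in sphere E k.+2 x) = false.
  by move=> zB; rewrite sph (sB _ _ zB).
case: (boolP (z \in nball E k x)) => [zk|zk].
  rewrite nb_in // s2 //; case: k kr zk {s2} => [|k] kr zk.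
    rewrite /sphere zk subn0 mul1n; move: zk; rewrite inE => /eqP ->.
    by rewrite nb_root // subn0.
  case: (boolP (z \in nball E k x)) => [zk'|zk'].
    by rewrite nb_in // sph zk' subnn.
  have zS : z \in sphere E k.+1 x by rewrite sph zk' zk.
  by have [_ ->] := nb_sphere (ltnW (ltnW kr)) zS; rewrite zS mul1n.
have -> : z \in sphere E k x = false.
  by apply/negP => /(subsetP (sphere_ball E k x)); apply/negP.
rewrite mul0n addn0; case: (boolP (z \in nball E k.+1 x)) => [zk1|zk1].
  have zS : z \in sphere E k.+1 x by rewrite sph zk zk1.
  by have [-> ->] := nb_sphere (ltnW kr) zS; rewrite sph zk1.
rewrite (nb_out zk1) subn0; case: (boolP (z \in nball E k.+2 x)) => [zk2|zk2].
  have zS : z \in sphere E k.+2 x by rewrite sph zk1 zk2.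
  by have [-> _] := nb_sphere kr zS; rewrite zS.
by rewrite nb_out // sph (negPf zk2) andbF.
Qed.

Section Harmonic.
Variables (R : comNzRingType) (f : T -> R) (a : R).
Hypothesis eigf : forall y, (\sum_(z | adj E y z) f z = a * f y)%R.
Local Open Scope ring_scope.

Local Notation F k := (\sum_(y in sphere E k x) f y).

Lemma sphere_sum0 : F 0%N = f x.
Proof. by rewrite /sphere big_set1. Qed.

Lemma sphere_sum1 : F 1%N = a * f x.
Proof.
rewrite -eigf; apply: eq_bigl => y; rewrite in_setD in_setU !inE.
case: eqP => [->|_] /=; first by rewrite adj_irrefl.
apply/existsP/idP => [[z /andP[]]|xy]; first by rewrite inE => /eqP ->.
by exists x; rewrite inE eqxx.
Qed.

(** Sum the eigenvalue equation over the sphere of radius [k.+1] and exchange the sums: [f z] is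
    counted once for each neighbour of [z] on that sphere. *)
Lemma sphere_sumSS k : (k.+2 <= r)%N ->
  F k.+2 = a * F k.+1 - (d - (0 < k))%:R * F k.
Proof.
move=> kr; apply/eqP; rewrite eq_sym subr_eq; apply/eqP.
rewrite mulr_sumr; under eq_bigr do rewrite -eigf.
rewrite (exchange_big_dep predT) //= mulr_sumr.
rewrite [X in _ = X + _]big_mkcond [X in _ = _ + X]big_mkcond -big_split /=.
apply: eq_bigr => z _.
transitivity (#|[set y | adj E z y] :&: sphere E k.+1 x|%:R * f z).
  rewrite -sum1_card natr_sum mulr_suml; apply: eq_big => [y|y _]; last by rewrite mul1r.
  by rewrite in_setI inE andbC adj_sym.
rewrite card_nbhd_sphere // natrD natrM mulrDl.
by case: (z \in sphere E k.+2 x); case: (z \in sphere E k x); rewrite ?mul0r ?mul1r.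
Qed.
End Harmonic.

(** The constant function 1 is an eigenfunction with eigenvalue [d], so the same recurrence gives
    the sizes of the spheres. *)
Lemma card_sphere k : 0 < k -> k <= r -> 0 < d -> #|sphere E k x| = d * d.-1 ^ k.-1.
Proof.
move=> k0 kr d0.
have h1 y : (\sum_(z | adj E y z) 1 = d%:R * 1 :> int)%R.
  by rewrite mulr1 -(degE y) /deg -sum1_card natr_sum; apply: eq_bigl => z; rewrite inE.
have cS l : (\sum_(y in sphere E l x) 1 = #|sphere E l x|%:R :> int)%R.
  by rewrite -sum1_card natr_sum.
have dE : (d%:R = d.-1%:R + 1 :> int)%R by rewrite natr1 prednK.
have c1 : #|sphere E 1 x| = d.
  by apply/eqP; rewrite -(eqr_nat int) -cS (sphere_sum1 h1) mulr1.
case: k k0 kr => // k _; elim/ltn_ind: k => -[|k] IH kr; first by rewrite c1 muln1.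
apply/eqP; rewrite -(eqr_nat int) -cS (sphere_sumSS h1 kr) !cS IH ?(ltnW kr) //.
case: k IH kr => [|k] IH kr.
  rewrite /sphere cards1 subn0 /= expn1 expn0 muln1 natrM dE; apply/eqP; ring.
rewrite IH ?(ltnW (ltnW kr)) //= subn1 !natrM !natrX !exprS dE; apply/eqP; ring.
Qed.
End TreeSpheres.

(** * Growth of the radial recurrence and the resulting bound on a single entry *)

Section Decay.
Variable R : rcfType.
Local Open Scope ring_scope.

(* Inside the bulk |a| <= 2 sqrt q, the quadratic form F(k+1)^2 + q F(k)^2 - a F(k) F(k+1) is
   multiplied by exactly q at each step; outside, |F| grows by at least sqrt q. *)
Lemma recurrence_growth (F : nat -> R) (a q : R) r : 3 <= q ->
  F 1%N = a * F 0%N -> F 2 = a * F 1%N - (q + 1) * F 0%N ->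
  (forall k, (k.+3 <= r)%N -> F k.+3 = a * F k.+2 - q * F k.+1) ->
  forall k, (k.+2 <= r)%N ->
    q ^+ k.+2 * F 0%N ^+ 2 <= 8 * (q * F k.+1 ^+ 2 + F k.+2 ^+ 2).
Proof.
move=> q3 F1 F2 FS.
have q0 : 0 <= q by lra.
have [aq|aq] := lerP (a ^+ 2) (4 * q) => k kr.
  have En : forall k, (k.+2 <= r)%N -> F k.+2 ^+ 2 + q * F k.+1 ^+ 2 - a * F k.+1 * F k.+2 =
      q ^+ k * ((q + 1) ^+ 2 - a ^+ 2) * F 0%N ^+ 2.
    elim=> [_|l IH lr]; first by rewrite F2 F1; ring.
    transitivity (q * (F l.+2 ^+ 2 + q * F l.+1 ^+ 2 - a * F l.+1 * F l.+2)).
      by rewrite FS //; ring.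
    by rewrite (IH (ltnW lr)) (exprS q l); ring.
  have := En k kr; set u := F k.+1; set v := F k.+2; set z := F 0%N => Eq.
  (* Completing the square; this is where [a ^+ 2 <= 4 * q] makes the quadratic form nonnegative. *)
  have h1 : - (a * u * v) <= q * u ^+ 2 + v ^+ 2.
    have : 0 <= (v + a * u / 2) ^+ 2 + (q - a ^+ 2 / 4) * u ^+ 2.
      by rewrite addr_ge0 ?sqr_ge0 // mulr_ge0 ?sqr_ge0 //; lra.
    by lra.
  have h2 : q ^+ k * ((q + 1) ^+ 2 - a ^+ 2) * z ^+ 2 <= 2 * (q * u ^+ 2 + v ^+ 2) by lra.
  (* In the bulk [(q + 1)^2 - a^2] is at least [(q - 1)^2], and [4 (q - 1)^2 >= q^2] for
     [q >= 3]. *)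
  have h3 : q ^+ k.+2 * z ^+ 2 <= 4 * (q ^+ k * ((q + 1) ^+ 2 - a ^+ 2) * z ^+ 2).
    have -> : 4 * (q ^+ k * ((q + 1) ^+ 2 - a ^+ 2) * z ^+ 2) =
      (q ^+ k * z ^+ 2) * (4 * ((q + 1) ^+ 2 - a ^+ 2)) by ring.
    have -> : q ^+ k.+2 * z ^+ 2 = (q ^+ k * z ^+ 2) * q ^+ 2 by rewrite !exprS; ring.
    rewrite ler_wpM2l //; first by rewrite mulr_ge0 ?sqr_ge0 // exprn_ge0.
    by have := sqr_ge0 (q - 3); lra.
  lra.
pose s := Num.sqrt q.
have s2 : s ^+ 2 = q by rewrite sqr_sqrtr.
have s0 : 1 <= s by rewrite -[1]sqrtr1 ler_sqrt; lra.
have as2 : 2 * s <= `|a|.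
  by rewrite -(@ler_pXn2r _ 2%N) ?nnegrE //; [rewrite real_normK ?num_real // exprMn s2; lra|lra].
have step u v : s * `|v| <= `|u| -> s * `|u| <= `|a * u - q * v|.
  move=> uv; apply: le_trans (lerB_dist _ _).
  rewrite !normrM (ger0_norm q0) -s2; have := normr_ge0 u; nra.
have gr : forall l, (l < r)%N -> s * `|F l| <= `|F l.+1|.
  elim=> [_|[|l] IH lr].
  - by rewrite F1 normrM; have := normr_ge0 (F 0%N); nra.
  (* The root has coefficient [q + 1] instead of [q]; the stronger first step [|F 1| >= 2 s |F 0|]
     pays for the excess. *)
  - rewrite F2; apply: le_trans (lerB_dist _ _).
    rewrite normrM [X in _ - X]normrM (ger0_norm (_ : 0 <= q + 1)); last lra.
    have h1 : 2 * s * `|F 0%N| <= `|F 1%N| by rewrite F1 normrM ler_wpM2r.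
    have f0 := normr_ge0 (F 0%N); have f1 := normr_ge0 (F 1%N).
    have h2 : 2 * s * `|F 1%N| <= `|a| * `|F 1%N| by rewrite ler_wpM2r.
    have h3 : s * (2 * s * `|F 0%N|) <= s * `|F 1%N| by rewrite ler_wpM2l //; lra.
    have h4 : 1 * `|F 0%N| <= q * `|F 0%N| by rewrite ler_wpM2r //; lra.
    rewrite -s2 in h4 *; lra.
  - by rewrite (FS _ lr); apply: step; apply: IH; apply: ltnW.
have pw : forall l, (l <= r)%N -> q ^+ l * F 0%N ^+ 2 <= F l ^+ 2.
  elim=> [_|l IH lr]; first by rewrite expr0 mul1r.
  apply: (@le_trans _ _ (q * F l ^+ 2)).
    by rewrite exprS -mulrA ler_wpM2l // IH // ltnW.
  have := gr l lr; rewrite -(@ler_pXn2r _ 2%N) ?nnegrE ?mulr_ge0 //; last lra.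
  by rewrite exprMn s2 !real_normK ?num_real.
have := pw _ kr; have := pw k.+1 (ltnW kr).
have : q ^+ k.+2 * F 0%N ^+ 2 = q * (q ^+ k.+1 * F 0%N ^+ 2) by rewrite (exprS q k.+1) mulrA.
have : 0 <= q ^+ k.+2 * F 0%N ^+ 2 by rewrite mulr_ge0 ?sqr_ge0 // exprn_ge0.
by have := sqr_ge0 (F k.+1); nra.
Qed.

Lemma sum_sqr_le (I : finType) (S : {set I}) (f : I -> R) :
  (\sum_(i in S) f i) ^+ 2 <= #|S|%:R * \sum_(i in S) f i ^+ 2.
Proof.
set s := \sum_(i in S) f i; set c := #|S|%:R : R.
have [S0|S0] := eqVneq #|S| 0%N.
  rewrite /s /c S0 mul0r; have -> : S = set0 by apply/eqP; rewrite -cards_eq0 S0.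
  by rewrite big_set0 expr0n.
have c0 : 0 < c by rewrite ltr0n lt0n.
have : 0 <= \sum_(i in S) (c * f i - s) ^+ 2 by apply: sumr_ge0 => i _; apply: sqr_ge0.
have -> : \sum_(i in S) (c * f i - s) ^+ 2 = c * (c * \sum_(i in S) f i ^+ 2 - s ^+ 2).
  under eq_bigr do rewrite sqrrB.
  rewrite big_split sumrB /= sumr_const -/c.
  have -> : \sum_(i in S) (c * f i) ^+ 2 = c ^+ 2 * \sum_(i in S) f i ^+ 2.
    by rewrite mulr_sumr; apply: eq_bigr => i _; rewrite exprMn.
  have -> : \sum_(i in S) (c * f i * s *+ 2) = (c * s * s) *+ 2.
    rewrite sumrMnl -mulr_suml -mulr_sumr -/s; ring.
  rewrite -mulr_natr -/c; ring.
by rewrite pmulr_rge0 // subr_ge0.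
Qed.

(** There are [r - 1] pairs of consecutive spheres, each of mass at least [f x ^+ 2 / 16], and a
    sphere belongs to at most two pairs; hence the constant 32. *)
Lemma eigenfunction_decay (T : finType) (E : {set {set T}}) (d r : nat) (x : T)
    (f : T -> R) (a : R) :
  simple_graph E -> (forall y, deg E y = d) -> ~ branching E r x -> (4 <= d)%N ->
  (forall y, \sum_(z | adj E y z) f z = a * f y) ->
  r.-1%:R * f x ^+ 2 <= 32 * \sum_y f y ^+ 2.
Proof.
move=> sE degE tE d4 eigf.
pose F k := \sum_(y in sphere E k x) f y.
pose q : R := d%:R - 1.
have d4R : 4 <= d%:R :> R by rewrite ler_nat.
have q3 : 3 <= q by rewrite /q; lra.
have dq : d%:R = q + 1 :> R by rewrite /q subrK.
have d1q : d.-1%:R = q :> R by rewrite /q -subn1 natrB //; lia.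
pose V k := \sum_(y in sphere E k x) f y ^+ 2.
pose Q k := \sum_(y in nball E k x) f y ^+ 2.
have QS k : Q k.+1 = Q k + V k.+1.
  rewrite /Q (big_setID (nball E k x)) /=; congr (_ + _).
  by rewrite (setIidPr (nballS E k x)).
have Qle k : Q k <= \sum_y f y ^+ 2.
  rewrite [leRHS](bigID (mem (nball E k x))) /= lerDl.
  by apply: sumr_ge0 => y _; apply: sqr_ge0.
have Q0 k : 0 <= Q k by apply: sumr_ge0 => y _; apply: sqr_ge0.
(* Cauchy-Schwarz on a sphere of size [(q + 1) q^k], which is at most [2 q^(k+1)]. *)
have VF k : (k.+1 <= r)%N -> F k.+1 ^+ 2 <= 2 * q ^+ k.+1 * V k.+1.
  move=> kr; apply: le_trans (sum_sqr_le _ _) _.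
  rewrite ler_wpM2r ?sumr_ge0 // => [y _|]; first exact: sqr_ge0.
  rewrite (card_sphere sE degE tE) // ?(leq_trans _ d4) // natrM natrX d1q dq exprS /=.
  by rewrite mulrA ler_wpM2r ?exprn_ge0 //; lra.
have grow k : (k.+2 <= r)%N -> F 0%N ^+ 2 <= 16 * (V k.+1 + V k.+2).
  move=> kr; have h : q ^+ k.+2 * F 0%N ^+ 2 <= 8 * (q * F k.+1 ^+ 2 + F k.+2 ^+ 2).
    apply: (@recurrence_growth F a q r _ _ _ _ k kr) => //.
    - by rewrite /F (sphere_sum1 _ sE eigf) sphere_sum0.
    - rewrite -dq -[in d%:R](subn0 d); apply: (@sphere_sumSS _ _ _ _ _ sE degE tE _ _ _ eigf 0).
      exact: leq_trans kr.
    - by move=> l lr; rewrite /F (sphere_sumSS sE degE tE eigf) //= subn1 d1q.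
  have qk : 0 < q ^+ k.+2 by rewrite exprn_gt0 //; lra.
  rewrite -(ler_pM2l qk); apply: le_trans h _.
  have := VF k.+1 kr; have := VF k (ltnW kr); rewrite [q ^+ k.+2]exprS => h1 h2.
  have : q * F k.+1 ^+ 2 <= q * (2 * q ^+ k.+1 * V k.+1) by rewrite ler_wpM2l //; lra.
  lra.
have sumQ k : (k.+1 <= r)%N -> k%:R * F 0%N ^+ 2 <= 16 * (Q k + Q k.+1).
  elim: k => [|k IH] kr; first by rewrite mul0r mulr_ge0 // addr_ge0.
  have := IH (ltnW kr); have := grow k kr; rewrite (QS k.+1) (QS k) -natr1; lra.
case: r tE VF grow sumQ => [|k] tE VF grow sumQ /=.
  by rewrite mul0r mulr_ge0 // sumr_ge0 // => y _; apply: sqr_ge0.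
have := sumQ k (leqnn _); rewrite {1}/F sphere_sum0.
by have := Qle k; have := Qle k.+1; lra.
Qed.
End Decay.

(** * Acyclic vertices of a random regular graph *)

From mathcomp Require Import all_classical all_reals all_analysis.
Import numFieldNormedType.Exports.
Local Open Scope ring_scope.

Section AcyclicVertices.
Variables (R : realType) (T : finType).
Implicit Types (E : {set {set T}}) (x : T) (r : R).

(** Distances are integers or infinite, so a real radius may be truncated. *)
Lemma gball_ball E r x : 0 <= r -> gball E r x = nball E (Num.trunc r) x.
Proof.
move=> r0; have /andP[tr rt] := truncn_itv r0.
apply/setP => y; rewrite finset.in_set; apply/idP/nballP => [dxy|[p [xp lp sp]]]; last first.
  apply: (@le_trans _ _ (size p)%:R%:E).
    by apply: ereal_inf_lbound; exists p.
  by rewrite lee_fin; apply: le_trans tr; rewrite ler_nat.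
apply: contrapT => noP.
have : ((Num.trunc r).+1%:R%:E <= gdist R E x y)%E.
  apply: le_ereal_inf_tmp => _ [p [xp lp] <-]; rewrite lee_fin ler_nat ltnNge.
  by apply/negP => sp; apply: noP; exists p.
by move=> /le_trans/(_ dxy); rewrite lee_fin leNgt rt.
Qed.

(** A cycle of the neighbourhood forces a branching; conversely the lollipop of a branching stays in
    the ball, so its cycle lies in the neighbourhood. *)
Lemma acyclic_verticesPn E r x : simple_graph E -> 0 <= r ->
  x \notin acyclic_vertices E r <-> branching E (Num.trunc r) x.
Proof.
move=> sE r0; have adjE a b : adj (nbhd_graph E r x) a b =
    adj E a b && ([set a; b]%SET \subset nball E (Num.trunc r) x).
  by rewrite /adj inE gball_ball.
rewrite inE; split=> [/asboolPn/existsNP[c]|br].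
  move=> /not_implyP[sc /negP/negPn /andP[cc uc]].
  have ccE : cycle (adj E) c.
    by apply: sub_cycle cc => a b; rewrite adjE => /andP[].
  apply: (@cycle_branching _ E _ x c sE sc); first by apply/andP.
  move=> y yc; have := next_cycle cc yc; rewrite adjE => /andP[_ /fintype.subsetP]; apply.
  exact: set21.
apply/asboolPn => ac; have [p [j [lol _ pB]]] := branching_lollipop sE br.
have [sc /andP[cc uc]] := lollipop_cycle lol.
have := ac _ sc; rewrite /ucycleb uc andbT => /negP; apply.
have cB : all (mem (nball E (Num.trunc r) x)) (drop j (x :: p)).
  by apply/allP => y /mem_drop /pB.
apply: (sub_in_cycle _ cB cc) => a b aB bB ab; rewrite adjE ab.
by apply/fintype.subsetP => z /set2P[] ->.
Qed.
End AcyclicVertices.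

Section LocalizedMass.
Variable R : realType.

(** Each vertex of [T] carries at most [32 / (r - 1)] of the unit mass; the total over [T] is
    compared with [1 - delta]. *)
Lemma localized_mass n d (E : {set {set 'I_n}}) (T : {set 'I_n}) (delta r : R) :
  E \in regular_graphs n d -> (4 <= d)%N -> 0 <= r ->
  T \subset acyclic_vertices E r -> has_localized_eigenvector (adjmx R E) T delta ->
  (1 - delta) * (Num.trunc r).-1%:R <= 32 * #|T|%:R.
Proof.
rewrite inE => /andP[sE /forallP dE] d4 r0 TJ [a [v [/eigenspaceP eigv [v1 vT]]]].
have degE y : deg E y = d by apply/eqP.
have sum1 : \sum_j v 0 j ^+ 2 = 1.
  have /(congr1 (fun z => z ^+ 2)) := v1; rewrite /l2norm sqr_sqrtr; last first.
    by apply: sumr_ge0 => j _; apply: sqr_ge0.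
  by rewrite expr1n => <-; apply: eq_bigr => j _; rewrite real_normK ?num_real.
have eigf y : \sum_(z | adj E y z) v 0 z = a * v 0 y.
  move/matrixP: eigv => /(_ 0 y); rewrite !mxE => <-.
  rewrite big_mkcond; apply: eq_bigr => z _; rewrite mxE adj_sym.
  by case: (adj E z y); rewrite ?mulr1 ?mulr0.
apply: (@le_trans _ _ ((\sum_(j in T) `|v 0 j| ^+ 2) * (Num.trunc r).-1%:R)).
  by rewrite ler_wpM2r.
rewrite mulr_suml mulr_natr -sumr_const; apply: ler_sum => j jT.
rewrite real_normK ?num_real // mulrC.
have nb : ~ branching E (Num.trunc r) j.
  by move/(acyclic_verticesPn j sE r0); rewrite (fintype.subsetP TJ).
by have := eigenfunction_decay sE degE nb d4 eigf; rewrite sum1 mulr1.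
Qed.
End LocalizedMass.

(** * Union bound and Markov's inequality for vertices with a cycle nearby *)

Section Probability.
Variable R : realType.

Lemma unif_prob_ge0 (X : finType) (S : {set X}) (Q : X -> Prop) : 0 <= unif_prob R S Q.
Proof. by rewrite divr_ge0. Qed.

Lemma le_unif_prob (X : finType) (S : {set X}) (Q Q' : X -> Prop) :
  (forall z, z \in S -> Q z -> Q' z) -> unif_prob R S Q <= unif_prob R S Q'.
Proof.
move=> QQ'; rewrite ler_wpM2r ?invr_ge0 // ler_nat; apply/subset_leq_card/fintype.subsetP => z.
by rewrite !inE => /andP[zS /asboolP /(QQ' z zS) Qz]; rewrite zS; apply/asboolP.
Qed.

(** [S] must be nonempty: division by zero gives 0, so over an empty set both probabilities
    vanish. *)
Lemma unif_probC (X : finType) (S : {set X}) (Q : X -> Prop) : S != finset.set0 ->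
  unif_prob R S (fun z => ~ Q z) = 1 - unif_prob R S Q.
Proof.
move=> S0; have S0' : #|S|%:R != 0 :> R by rewrite pnatr_eq0 cards_eq0.
apply/eqP; rewrite eq_sym subr_eq -mulrDl -natrD; apply/eqP.
rewrite -[LHS](divff S0'); congr (_%:R / _).
rewrite -(cardsID [set z | `[< Q z >]]%SET S) addnC; congr addn; apply: eq_card => z.
  by rewrite !inE asbool_neg andbC.
by rewrite !inE.
Qed.

Section Regular.
Variables (n d : nat) (zeta : R).
(** A strict bound for the tail lengths given by [branching_lollipop]. *)
Let K := (Num.trunc zeta).*2.+2.
Hypotheses (zeta_ge0 : 0 <= zeta) (d_gt0 : (0 < d)%N).

Lemma not_acyclic_lollipop (E : {set {set 'I_n}}) x : simple_graph E ->
  x \notin acyclic_vertices E zeta ->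
  exists p j, lollipop E (x :: p) j /\ (size p < K)%N.
Proof.
move=> sE /(acyclic_verticesPn x sE zeta_ge0) /(branching_lollipop sE)[p [j [lol sp _]]].
by exists p, j.
Qed.

Lemma prob_not_acyclic (T : {set 'I_n}) :
  (4 * K + 8 * d + 4 * d ^ 2 <= n * d)%N ->
  prob_reg R d (fun E : {set {set 'I_n}} => ~ (T \subset acyclic_vertices E zeta)) <=
    #|T|%:R * (code_weight R d K / n%:R).
Proof.
move=> nd; have [S0|S0] := eqVneq (regular_graphs n d) finset.set0.
  by rewrite /prob_reg /unif_prob S0 cards0 invr0 mulr0 mulr_ge0 // divr_ge0 // mulr_ge0 ?exprn_ge0.
have S0' : 0 < #|regular_graphs n d|%:R :> R by rewrite ltr0n card_gt0.
rewrite /prob_reg /unif_prob ler_pdivrMr // -mulrA.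
apply: le_trans (_ : \sum_(x in T) (code_weight R d K / n%:R * #|regular_graphs n d|%:R) <= _); last first.
  by rewrite sumr_const mulr_natl.
apply: le_trans (ler_sum _ (fun x _ => @has_code_rooted R n d K x d_gt0 nd)).
rewrite -natr_sum ler_nat; apply: leq_trans (leq_card_bigcup _ _).
apply/subset_leq_card/fintype.subsetP => E; rewrite inE => /andP[rE /asboolP/negP/subsetPn[x xT xJ]].
apply/bigcupP; exists x => //; rewrite inE rE; apply/existsP.
have sE : simple_graph E by move: rE; rewrite inE => /andP[].
have [p [j [lol sp]]] := not_acyclic_lollipop sE xJ.
have [[x' c] [ok /= <- _ cE]] := code_okP lol sp.
by exists c; rewrite ok.
Qed.

(** Markov's inequality for the number of chains: its mean is at most [code_weight ^+ m], while on
    [Q] it is at least [b ^ m]. *)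
Lemma prob_many_not_acyclic (m b : nat) (Q : {set {set 'I_n}} -> Prop) :
  (4 * (m * K) + 8 * d + 4 * d ^ 2 <= n * d)%N -> (0 < b)%N ->
  (forall E, Q E -> (b + m * K * d.+1 ^ K <= #|~: acyclic_vertices E zeta|)%N) ->
  prob_reg R d Q <= (code_weight R d K / b%:R) ^+ m.
Proof.
move=> nd b0 hQ; have [S0|S0] := eqVneq (regular_graphs n d) finset.set0.
  by rewrite /prob_reg /unif_prob S0 cards0 invr0 mulr0 exprn_ge0 // divr_ge0 // mulr_ge0 ?exprn_ge0.
have S0' : 0 < #|regular_graphs n d|%:R :> R by rewrite ltr0n card_gt0.
have b0' : 0 < b%:R ^+ m :> R by rewrite exprn_gt0 // ltr0n.
rewrite /prob_reg /unif_prob ler_pdivrMr // expr_div_n mulrAC ler_pdivlMr //.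
have -> : regular_graphs n d = regular_sup d finset.set0.
  by apply/setP => E; rewrite [RHS]inE finset.sub0set andbT.
apply: le_trans (@sum_chains R n d K m finset.set0 finset.set0 d_gt0 _ _); last first.
- by rewrite cards0 add0n.
- by move=> e; rewrite inE.
rewrite -natrX -natrM -natr_sum ler_nat -sum_nat_const.
rewrite [leqRHS](bigID (fun E => `[< Q E >])) /=; apply: leq_trans (leq_addr _ _).
rewrite (eq_bigl (fun E => (E \in regular_sup d finset.set0) && `[< Q E >])); last first.
  by move=> E; rewrite inE.
apply: leq_sum => E /andP[rE /asboolP /hQ QE].
have rE' : E \in regular_graphs n d by move: rE; rewrite inE => /andP[].
apply: (chains_lower (B := ~: acyclic_vertices E zeta) rE'); last by rewrite cards0; apply: QE.
move=> x; rewrite inE; apply: not_acyclic_lollipop.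
by move: rE'; rewrite inE => /andP[].
Qed.
End Regular.
End Probability.

(** * Asymptotics *)

Local Open Scope classical_set_scope.
Local Open Scope ring_scope.

Section Asymptotics.
Variable R : realType.
Implicit Types (p x : R).

Lemma near_ln_ge (A : R) : \forall n \near \oo, A <= ln n%:R.
Proof.
near=> n; have nA : expR A <= n%:R by near: n; apply: nbhs_infty_ger.
by rewrite -[A]expRK ler_ln // posrE ?(lt_le_trans _ nA) // expR_gt0.
Unshelve. all: end_near. Qed.

Lemma near_ln_powR_ge (C p : R) : 0 < p -> \forall n \near \oo, C <= (ln n%:R : R) `^ p.
Proof.
move=> p0; near=> n.
have h : `|C| `^ p^-1 <= ln n%:R by near: n; apply: near_ln_ge.
apply: le_trans (ler_norm C) _.
have -> : `|C| = (`|C| `^ p^-1) `^ p by rewrite -powRrM mulVf ?powRr1 // lt0r_neq0.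
apply: ge0_ler_powR => //; rewrite ?nnegrE ?powR_ge0 ?(ltW p0) //.
exact: le_trans (powR_ge0 _ _) h.
Unshelve. all: end_near. Qed.

Lemma ln_le_powR p x : 0 < p -> 0 < x -> ln x <= x `^ p / p.
Proof.
move=> p0 x0; rewrite ler_pdivlMr // mulrC -ln_powR.
by rewrite ltW // ln_sublinear // powR_gt0.
Qed.

(** With [L = ln (d - 1)], the [-4] in [zeta_n] absorbs the rounding, so [2 K L <= ln n]. The weight
    is at most [exp (K (6 + L))], and [L >= 18] gives [6 + L <= 4 L / 3]. *)
Lemma code_weight_le (n d : nat) : 0 <= zeta_n R n d -> 18 <= ln (d%:R - 1 : R) ->
  code_weight R d (Num.trunc (zeta_n R n d)).*2.+2 <= expR (2 / 3 * ln n%:R).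
Proof.
move=> z0; set L := ln _ => L18; set K := _.*2.+2; set l := ln n%:R.
have Q1 : 1 < d%:R - 1 :> R by rewrite ltNge; apply/negP => /ln_le0; rewrite -/L; lra.
have L0 : 0 < L by lra.
have KL : K%:R * (2 * L) <= l.
  have /andP[tz _] := truncn_itv z0.
  have zL : zeta_n R n d * (2 * L) = l / 2 - 8 * L by rewrite /zeta_n -/L -/l; field; rewrite gt_eqF.
  have -> : K%:R = 2 * (Num.trunc (zeta_n R n d))%:R + 2 :> R.
    by rewrite /K -addn2 natrD -mul2n natrM.
  have : (Num.trunc (zeta_n R n d))%:R * (2 * L) <= zeta_n R n d * (2 * L).
    by rewrite ler_wpM2r //; lra.
  lra.
have e1 : K%:R ^+ 2 <= expR (2 * K%:R) :> R.
  rewrite expRM_natl ler_pXn2r ?nnegrE ?expR_ge0 //.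
  by apply: le_trans (expR_ge1Dx _); lra.
have e2 : (2 * d)%:R ^+ K <= expR (K%:R * (4 + L)) :> R.
  rewrite expRM_natl ler_pXn2r ?nnegrE ?expR_ge0 // natrM.
  have -> : expR (4 + L) = expR 4 * (d%:R - 1) by rewrite expRD lnK // posrE; lra.
  have : 1 + 4 <= expR 4 :> R by apply: expR_ge1Dx.
  set e := expR 4 => e5; have : 5 * (d%:R - 1) <= e * (d%:R - 1) :> R by rewrite ler_wpM2r; lra.
  lra.
have : code_weight R d K <= expR (2 * K%:R) * expR (K%:R * (4 + L)).
  by rewrite ler_pM // exprn_ge0.
move=> /le_trans; apply; rewrite -expRD ler_expR.
have k0 : 0 <= K%:R :> R by [].
have : 0 <= K%:R * (L - 18) by rewrite mulr_ge0 // subr_ge0.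
lra.
Qed.

(** [eta_n] is the hyperbolic sine of [d^(-alpha)]. *)
Lemma eta_n_ge (alpha : R) (d : nat) : (d%:R `^ (- alpha)) / 2 <= eta_n alpha d.
Proof.
rewrite /eta_n -expRN; set x := _ `^ _.
have x0 : 0 <= x by apply: powR_ge0.
have e1 : 1 + x <= expR x := expR_ge1Dx x.
have e2 : expR (- x) <= 1 by rewrite -expR0 ler_expR; lra.
rewrite ler_wpM2r //; lra.
Qed.

Section Scale.
Variables (gamma alpha : R) (d : nat -> nat).
Hypotheses (gamma_gt0 : 0 < gamma) (alpha_bnd : 0 < alpha < Num.min 1 gamma^-1).
Hypothesis d_round : \forall n \near \oo, `|(d n)%:R - (ln n%:R) `^ gamma| < 2 :> R.

Local Notation zeta n := (zeta_n R n (d n)).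
Local Notation eta n := (eta_n alpha (d n)).

Lemma near_degree_ge (A : R) : \forall n \near \oo, A <= (d n)%:R.
Proof.
near=> n; have dn : `|(d n)%:R - (ln n%:R) `^ gamma| < 2 :> R by near: n.
have : A + 2 <= (ln n%:R) `^ gamma by near: n; apply: near_ln_powR_ge.
by move: dn; rewrite ltr_norml => /andP[]; lra.
Unshelve. all: end_near. Qed.

Lemma near_degree_le : \forall n \near \oo, (d n)%:R <= 2 * (ln n%:R) `^ gamma :> R.
Proof.
near=> n; have dn : `|(d n)%:R - (ln n%:R) `^ gamma| < 2 :> R by near: n.
have : 2 <= (ln n%:R) `^ gamma by near: n; apply: near_ln_powR_ge.
by move: dn; rewrite ltr_norml => /andP[]; lra.
Unshelve. all: end_near. Qed.

(** [ln (d n)] is of order [ln (ln n)]. The power is split into two equal factors: one dominates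
    [ln (ln n)] up to a constant, the other beats the constants. *)
Lemma near_ln_degree (p : R) : 0 < p -> \forall n \near \oo, ln (d n)%:R <= (ln n%:R) `^ p.
Proof.
move=> p0; have p2 : 0 < p / 2 by rewrite divr_gt0.
near=> n.
have l1 : 1 <= ln n%:R :> R by near: n; apply: near_ln_ge.
have d1 : 1 <= (d n)%:R :> R by near: n; apply: near_degree_ge.
have dn : (d n)%:R <= 2 * (ln n%:R) `^ gamma :> R by near: n; apply: near_degree_le.
have h : 1 + gamma / (p / 2) + 1 <= (ln n%:R) `^ (p / 2) by near: n; apply: near_ln_powR_ge.
set l : R := ln n%:R in l1 dn h *.
have lp1 : 1 <= l `^ (p / 2).
  by apply: le_trans h; rewrite -addrA lerDl addr_ge0 // divr_ge0 // ltW.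
have -> : l `^ p = l `^ (p / 2) * l `^ (p / 2).
  by rewrite -powRD -?splitr //; apply/implyP => _; rewrite gt_eqF //; lra.
have lg0 : 0 < l `^ gamma by rewrite powR_gt0; lra.
apply: (@le_trans _ _ (ln (2 * l `^ gamma))).
  by rewrite ler_ln ?posrE //; [lra|rewrite mulr_gt0].
rewrite lnM ?posrE // ln_powR.
have : ln 2 < 2 :> R by apply: ln_sublinear.
have : gamma * ln l <= gamma * (l `^ (p / 2) / (p / 2)).
  by rewrite ler_wpM2l ?(ltW gamma_gt0) // ln_le_powR //; lra.
set g := gamma / (p / 2) in h *; set y := l `^ (p / 2) in h lp1 *.
have -> : gamma * (y / (p / 2)) = g * y by rewrite /g; ring.
have : (1 + g + 1) * y <= y * y by rewrite ler_wpM2r //; lra.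
lra.
Unshelve. all: end_near. Qed.

(* The acyclic radius is of order log n / loglog n, whereas 1 / eta = (log n)^(gamma alpha) up to
   constants, with gamma alpha < 1. *)
Lemma near_radius : \forall n \near \oo,
  0 <= zeta n /\ (eta n)^-1 <= (Num.trunc (zeta n)).-1%:R.
Proof.
have /andP[a0] := alpha_bnd; rewrite lt_min => /andP[a1 ag].
pose b := gamma * alpha; have b1 : b < 1.
  by rewrite /b mulrC -ltr_pdivlMr // mul1r.
have b0 : 0 < b by rewrite mulr_gt0.
(* Half the gap below 1, so that [l = l^p * l^p * l^b]: one [l^p] outgrows [ln (d - 1)], the other
   the constants. *)
pose p := (1 - b) / 2; have p0 : 0 < p by rewrite divr_gt0 // subr_gt0.
near=> n.
have l1 : 1 <= ln n%:R :> R by near: n; apply: near_ln_ge.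
have d3 : 3 <= (d n)%:R :> R by near: n; apply: near_degree_ge.
have dn : (d n)%:R <= 2 * (ln n%:R) `^ gamma :> R by near: n; apply: near_degree_le.
have lp : 40 <= (ln n%:R) `^ p :> R by near: n; apply: near_ln_powR_ge.
have ld : ln (d n)%:R <= (ln n%:R) `^ p :> R by near: n; apply: near_ln_degree.
set l : R := ln n%:R in l1 dn lp ld *.
have lb : 1 <= l `^ b by rewrite -(powRr0 l) ler_powR // ltW.
have L0 : 0 < ln ((d n)%:R - 1) :> R by rewrite ln_gt0 //; lra.
have Lp : ln ((d n)%:R - 1) <= l `^ p :> R.
  by apply: le_trans ld; rewrite ler_ln ?posrE; lra.
have lpp : l = l `^ p * (l `^ p * l `^ b).
  rewrite -!powRD ?gt_eqF ?implybT //; try lra.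
  by rewrite (_ : p + (p + b) = 1) ?powRr1 //; [lra|rewrite /p; field].
have zl : l `^ p * l `^ b / 4 - 4 <= zeta n.
  have : l `^ p * l `^ b <= l / ln ((d n)%:R - 1).
    rewrite ler_pdivlMr // [leRHS]lpp mulrC ler_wpM2r //.
    by rewrite mulr_ge0 // powR_ge0.
  by rewrite /zeta_n -/l; lra.
have lpb : 40 * l `^ b <= l `^ p * l `^ b by rewrite ler_wpM2r // powR_ge0.
have z0 : 0 <= zeta n by lra.
split=> //.
have da0 : 0 < (d n)%:R `^ alpha :> R by rewrite powR_gt0; lra.
have eh : (2 * (d n)%:R `^ alpha)^-1 <= eta n.
  by rewrite invfM mulrC -powRN; apply: eta_n_ge.
have i0 : 0 < (2 * (d n)%:R `^ alpha)^-1 :> R by rewrite invr_gt0 mulr_gt0.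
have : (eta n)^-1 <= 2 * (d n)%:R `^ alpha.
  by rewrite -[leRHS]invrK lef_pV2 ?posrE //; apply: lt_le_trans eh.
have : (d n)%:R `^ alpha <= 2 * l `^ b.
  apply: (@le_trans _ _ ((2 * l `^ gamma) `^ alpha)).
    by rewrite ge0_ler_powR ?nnegrE ?mulr_ge0 ?powR_ge0 ?(ltW a0).
  rewrite powRM ?powR_ge0 // -powRrM ler_wpM2r ?powR_ge0 //.
  by apply: ler1_powR; lra.
have /andP[_ zt] := truncn_itv z0.
have : (Num.trunc (zeta n)).+1%:R - 2 <= (Num.trunc (zeta n)).-1%:R :> R.
  case: (Num.trunc (zeta n)) => [|k] /=; first by lra.
  by rewrite -[k.+2]addn2 natrD addrK.
lra.
Unshelve. all: end_near. Qed.

(* All quantities are compared with powers of u = n^(1/48). *)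
Lemma near_scale (A : R) : \forall n \near \oo, let u := expR (ln n%:R / 48) in
  [/\ A <= u, n%:R = u ^+ 48, (d n)%:R <= u,
      code_weight R (d n) (Num.trunc (zeta n)).*2.+2 <= u ^+ 32 &
      (2 * (d n)%:R)^-1 <= eta n].
Proof.
have /andP[a0] := alpha_bnd; rewrite lt_min => /andP[a1 ag].
near=> n.
have l1 : 1 <= ln n%:R :> R by near: n; apply: near_ln_ge.
have lA : 48 * A <= ln n%:R by near: n; apply: near_ln_ge.
have n0 : 0 < n%:R :> R by near: n; apply: nbhs_infty_gtr.
have dL : expR 18 + 1 <= (d n)%:R :> R by near: n; apply: near_degree_ge.
have ld : ln (d n)%:R <= (ln n%:R) `^ 2^-1 :> R by near: n; apply: near_ln_degree.
have l48 : 48 <= (ln n%:R) `^ 2^-1 :> R by near: n; apply: near_ln_powR_ge.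
have [z0 _] : 0 <= zeta n /\ (eta n)^-1 <= (Num.trunc (zeta n)).-1%:R.
  by near: n; apply: near_radius.
set l : R := ln n%:R in l1 lA ld l48 *; set u := expR (l / 48).
have e18 : 1 + 18 <= expR 18 :> R := expR_ge1Dx _.
split.
- by apply: le_trans (expR_ge1Dx _); lra.
- by rewrite /u -expRM_natl mulrC divfK // lnK.
- rewrite -[leLHS]lnK ?posrE; last lra.
  rewrite ler_expR; apply: le_trans ld _.
  have : l = l `^ 2^-1 * l `^ 2^-1.
    by rewrite -powRD ?gt_eqF ?implybT ?(lt_le_trans _ l1) // -[2^-1]div1r -splitr powRr1 //; lra.
  set y := l `^ 2^-1 in l48 * => ly; rewrite ler_pdivlMr // ly.
  by rewrite ler_wpM2l //; lra.
(* The exponent 32 is two thirds of 48, matching [code_weight_le]. *)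
- rewrite /u -expRM_natl (_ : 32%:R * (l / 48) = 2 / 3 * l); last by field.
  apply: code_weight_le => //; rewrite -[18]expRK ler_ln ?posrE ?expR_gt0 //; lra.
- apply: le_trans (eta_n_ge alpha (d n)).
  rewrite invfM mulrC ler_wpM2r // -powR_inv1; last lra.
  by rewrite ler_powR; lra.
Unshelve. all: end_near. Qed.
End Scale.
End Asymptotics.

(** * Explicit probability bounds in powers of [u] *)

Section Estimates.
Variables (R : realType) (n d : nat) (zeta eta u : R).
Let K := (Num.trunc zeta).*2.+2.

(** The left side is at most [(16 + 8 + 4) u^32], which explains the threshold 28. *)
Lemma size_cond : 28 <= u -> 4 <= d%:R :> R -> n%:R = u ^+ 48 -> d%:R <= u ->
  code_weight R d K <= u ^+ 32 -> (4 * (4 * K) + 8 * d + 4 * d ^ 2 <= n * d)%N.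
Proof.
move=> u28 d4 nu du Ku; have d_gt0 : (0 < d)%N by rewrite -(ltr_nat R); lra.
have uX i j : (i <= j)%N -> u ^+ i <= u ^+ j by apply: ler_weXn2l; lra.
have K32 : K%:R <= u ^+ 32 :> R.
  apply: le_trans Ku; rewrite /code_weight expr2 -mulrA -[leLHS]mulr1 ler_wpM2l //.
  by rewrite -natrX -natrM ler1n muln_gt0 expn_gt0 muln_gt0 d_gt0.
rewrite -(ler_nat R) !natrD !natrM nu -expr2.
have h1 : u ^+ 48 <= u ^+ 48 * d%:R.
  by rewrite -[leLHS]mulr1 ler_wpM2l ?exprn_ge0 //; lra.
have h2 : d%:R ^+ 2 <= u ^+ 2 by rewrite ler_pXn2r ?nnegrE //; lra.
have h3 : u ^+ 1 <= u ^+ 32 by apply: uX.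
have h4 : u ^+ 2 <= u ^+ 32 by apply: uX.
have h5 : 28 * u ^+ 32 <= u ^+ 33 by rewrite (exprS u 32) ler_wpM2r ?exprn_ge0 //; lra.
have h6 : u ^+ 33 <= u ^+ 48 by apply: uX.
rewrite expr1 in h3; lra.
Qed.

(** [#|T| <= 2 d <= 2 u] and each vertex fails with probability at most [u^(-16)], that is
    [n^(-1/3)]. *)
Lemma prob_not_acyclic_le (T : {set 'I_n}) : 0 <= zeta ->
  28 <= u -> 4 <= d%:R :> R -> n%:R = u ^+ 48 -> d%:R <= u ->
  code_weight R d K <= u ^+ 32 -> (2 * d%:R)^-1 <= eta -> #|T|%:R <= eta^-1 ->
  prob_reg R d (fun E : {set {set 'I_n}} => ~ (T \subset acyclic_vertices E zeta)) <=
  2 / u * d%:R^-1.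
Proof.
move=> zeta_ge0 u28 d4 nu du Ku eta_ge Teta.
have d_gt0 : (0 < d)%N by rewrite -(ltr_nat R); lra.
have uX i j : (i <= j)%N -> u ^+ i <= u ^+ j by apply: ler_weXn2l; lra.
have nd : (4 * K + 8 * d + 4 * d ^ 2 <= n * d)%N.
  by apply: leq_trans (size_cond u28 d4 nu du Ku); rewrite !leq_add2r leq_mul2l /= mulnC leq_pmulr.
apply: le_trans (prob_not_acyclic zeta_ge0 d_gt0 _ nd) _.
have D0 : 0 < d%:R :> R by lra.
have u0 : 0 < u by lra.
have eta0 : 0 < eta by apply: lt_le_trans eta_ge; rewrite invr_gt0 mulr_gt0.
have T2 : #|T|%:R <= 2 * d%:R :> R.
  apply: le_trans Teta _; rewrite -[leRHS]invrK lef_pV2 ?posrE //.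
  by rewrite invr_gt0 mulr_gt0.
have cn : code_weight R d K / n%:R <= u ^+ 32 / u ^+ 48.
  by rewrite nu ler_wpM2r // invr_ge0 exprn_ge0 // ltW.
have cn0 : 0 <= code_weight R d K / n%:R by rewrite divr_ge0 // mulr_ge0 ?exprn_ge0.
have h : #|T|%:R * (code_weight R d K / n%:R) <= (2 * u) * (u ^+ 32 / u ^+ 48).
  by rewrite ler_pM //; lra.
apply: le_trans h _; rewrite ler_pdivlMr //.
apply: (@le_trans _ _ (2 * u * (u ^+ 32 / u ^+ 48) * u)).
  by rewrite ler_wpM2l // mulr_ge0 ?divr_ge0 ?exprn_ge0 //; lra.
have -> : 2 * u * (u ^+ 32 / u ^+ 48) * u = 2 * u ^+ 34 / u ^+ 48.
  by rewrite -[34%N]/(32 + 2)%N exprD; ring.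
rewrite ler_pdivrMr ?exprn_gt0 // -mulrA ler_pM2l // mulrC ler_pdivlMr // -exprSr.
exact: uX.
Qed.

Lemma prob_few_acyclic : 0 <= zeta ->
  28 <= u -> 4 <= d%:R :> R -> n%:R = u ^+ 48 -> d%:R <= u ->
  code_weight R d K <= u ^+ 32 -> (2 * d%:R)^-1 <= eta ->
  prob_reg R d (fun E : {set {set 'I_n}} =>
    ~ (1 - eta / d%:R <= #|acyclic_vertices E zeta|%:R / n%:R)) <=
  16 / u ^+ 4 * n%:R^-1.
Proof.
move=> zeta_ge0 u28 d4 nu du Ku eta_ge.
have d_gt0 : (0 < d)%N by rewrite -(ltr_nat R); lra.
have uX i j : (i <= j)%N -> u ^+ i <= u ^+ j by apply: ler_weXn2l; lra.
have u0 : 0 < u by lra.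
have uu i : 0 < u ^+ i by rewrite exprn_gt0.
have D0 : 0 < d%:R :> R by lra.
(* On the bad event more than [u^46 / 2] vertices fail, which leaves room for [b] together with the
   greedy loss of at most [4 u^32]. *)
pose b := Num.trunc (u ^+ 45).
have /andP[bu ub] := truncn_itv (ltW (uu 45%N)); rewrite -/b in bu ub.
have b2 : u ^+ 45 / 2 <= b%:R.
  have : u ^+ 1 <= u ^+ 45 by apply: uX.
  by move: ub; rewrite -natr1 expr1; lra.
have b0 : (0 < b)%N by rewrite -(ltr_nat R); apply: lt_le_trans b2; rewrite divr_gt0.
(* Each lollipop gains a factor [2 u^(-13)]; four is the least number for which the gain [u^(-13 m)]
   beats [1/n = u^(-48)]. *)
apply: le_trans (prob_many_not_acyclic (m := 4) zeta_ge0 d_gt0 (size_cond u28 d4 nu du Ku) b0 _) _;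
  rewrite -/K.
  move=> E /negP; rewrite -ltNge => few.
  have KX : (4 * K * d.+1 ^ K)%:R <= 4 * u ^+ 32 :> R.
    rewrite -mulnA natrM ler_pM2l //; apply: le_trans Ku.
    rewrite /code_weight -!natrX -natrM ler_nat leq_mul //.
      by rewrite -mulnn leq_pmulr.
    by rewrite leq_exp2r // mul2n -addnn -add1n leq_add2r.
  have n0 : 0 < n%:R :> R by rewrite nu.
  have cardC : #|~: acyclic_vertices E zeta|%:R = n%:R - #|acyclic_vertices E zeta|%:R :> R.
    by rewrite cardsCs finset.setCK natrB ?card_ord // -[leqRHS](card_ord n) max_card.
  have many : u ^+ 48 * (eta / d%:R) < #|~: acyclic_vertices E zeta|%:R.
    by move: few; rewrite ltr_pdivrMr // cardC -nu; lra.
  have ed : (2 * u ^+ 2)^-1 <= eta / d%:R.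
    rewrite ler_pdivlMr //; apply: le_trans eta_ge.
    rewrite ler_pdivrMl ?mulr_gt0 // ler_pdivlMr ?mulr_gt0 //.
    have : d%:R * d%:R <= u * u by rewrite ler_pM //; lra.
    by rewrite expr2; lra.
  move: (4 * K * d.+1 ^ K)%N KX => w KX.
  rewrite -(ler_nat R) natrD; apply: le_trans (ltW many).
  have h1 : u ^+ 48 * (2 * u ^+ 2)^-1 <= u ^+ 48 * (eta / d%:R) by rewrite ler_pM2l.
  apply: le_trans h1; have -> : u ^+ 48 * (2 * u ^+ 2)^-1 = u * u ^+ 45 / 2.
    rewrite -exprS -[48%N]/(46 + 2)%N exprD; field; lra.
  have : u ^+ 32 <= u ^+ 45 by apply: uX.
  have : 28 * u ^+ 45 <= u * u ^+ 45 by rewrite ler_pM2r.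
  have := uu 45%N; lra.
have -> : 16 / u ^+ 4 * n%:R^-1 = (u ^+ 32 / (u ^+ 45 / 2)) ^+ 4.
  rewrite nu -[45%N]/(32 + 13)%N exprD; field; lra.
have b0' : 0 < b%:R :> R by rewrite ltr0n.
rewrite ler_pXn2r ?nnegrE //; [|by rewrite divr_ge0 // mulr_ge0 ?exprn_ge0|by rewrite !divr_ge0 // ltW].
have cw0 : 0 <= code_weight R d K by rewrite mulr_ge0 // exprn_ge0.
apply: ler_pM => //.
by rewrite lef_pV2 ?posrE // divr_gt0.
Qed.
End Estimates.

(** * Assembly of parts (i) and (ii) *)

Lemma unif_prob_eq0 (R : realType) (X : finType) (S : {set X}) (Q : X -> Prop) :
  (forall z, z \in S -> ~ Q z) -> unif_prob R S Q = 0.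
Proof.
move=> NQ; rewrite /unif_prob (_ : [set z in S | `[< Q z >]]%SET = finset.set0) ?cards0 ?mul0r //.
by apply/setP => z; rewrite !inE; apply/negP => /andP[/NQ Nz /asboolP].
Qed.

Lemma unif_prob_le1 (R : realType) (X : finType) (S : {set X}) (Q : X -> Prop) :
  unif_prob R S Q <= 1.
Proof.
have [S0|S0] := eqVneq #|S| 0%N; first by rewrite /unif_prob S0 invr0 mulr0.
rewrite ler_pdivrMr ?ltr0n ?lt0n // mul1r ler_nat; apply/subset_leq_card/fintype.subsetP => z.
by rewrite inE => /andP[].
Qed.

Theorem theorem3 (R : realType) (gamma alpha delta : R) (d : nat -> nat)
    (T : forall n : nat, {set 'I_n})
    (gamma_gt0 : 0 < gamma)
    (d_round : \forall n \near \oo, `|(d n)%:R - (ln n%:R) `^ gamma| < 2 :> R)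
    (d_exists : \forall n \near \oo, regular_graphs n (d n) != finset.set0)
    (alpha_bnd : 0 < alpha < Num.min 1 gamma^-1)
    (delta_bnd : 0 < delta < 1)
    (T_neq0 : forall n : nat, (0 < n)%N -> T n != finset.set0)
    (T_small : (fun n : nat => #|T n|%:R : R) =o_\oo
               (fun n : nat => (eta_n alpha (d n))^-1 : R)) :
  let Omega1 n (E : {set {set 'I_n}}) :=
    has_localized_eigenvector (adjmx R E) (T n) delta in
  let J n (E : {set {set 'I_n}}) := acyclic_vertices E (zeta_n R n (d n)) in
  (exists eps : nat -> R,
    [/\ eps =o_\oo (fun n : nat => (d n)%:R^-1 : R),
        \forall n \near \oo,
          expR (- (#|T n|%:R * eta_n alpha (d n) / (d n)%:R)) * (1 - eps n)
            <= prob_reg R (d n) (fun E => ~ Omega1 n E)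
      & (fun n : nat =>
          1 - expR (- (#|T n|%:R * eta_n alpha (d n) / (d n)%:R)) * (1 - eps n))
        =o_\oo (fun n : nat => (d n)%:R^-1 : R)]) /\
  (fun n : nat =>
     1 - prob_reg R (d n) (fun E =>
           1 - eta_n alpha (d n) / (d n)%:R <= #|J n E|%:R / n%:R))
    =o_\oo (fun n : nat => n%:R^-1 : R) /\
  (\forall n \near \oo,
     prob_reg R (d n) (fun E => T n \subset J n E /\ Omega1 n E) = 0).
Proof.
move=> Omega1 J; have /andP[delta0 delta1] := delta_bnd.
have small (e : R) : 0 < e -> \forall n \near \oo, #|T n|%:R <= e * (eta_n alpha (d n))^-1.
  move=> e0; have [/(_ T_small) h _] := eqoP eventually_filterType
    (fun n : nat => (eta_n alpha (d n))^-1 : R^o) (fun n : nat => #|T n|%:R : R^o).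
  have := h e e0; apply: filterS => n /=.
  rewrite !ger0_norm // invr_ge0.
  by apply: le_trans (eta_n_ge _ _); rewrite divr_ge0 // powR_ge0.
have scale A := near_scale gamma_gt0 alpha_bnd d_round A.
have radius := near_radius gamma_gt0 alpha_bnd d_round.
have degree A := near_degree_ge gamma_gt0 d_round A.
have eta_gt0 n : 4 <= (d n)%:R :> R -> 0 < eta_n alpha (d n).
  by move=> d4; apply: lt_le_trans (eta_n_ge _ _); rewrite divr_gt0 // powR_gt0; lra.
have excl : \forall n \near \oo, forall E, E \in regular_graphs n (d n) ->
    ~ (T n \subset J n E /\ Omega1 n E).
  (* With this constant [32 * #|T n|] is at most half of [(1 - delta) / eta], contradicting
     [localized_mass] since [1 / eta <= r - 1]. *)
  have c0 : 0 < (1 - delta) / 64 by lra.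
  apply: filterS (filterI radius (filterI (degree 4) (small _ c0))) => n [[z0 er] [d4 Ts]] E rE [TJ loc].
  have d4' : (4 <= d n)%N by rewrite -(ler_nat R).
  have := localized_mass rE d4' z0 TJ loc.
  have : 0 < (eta_n alpha (d n))^-1 by rewrite invr_gt0 eta_gt0.
  set r := (Num.trunc _).-1%:R in er *; set h := _^-1 in er Ts * => h0 le1.
  have : (1 - delta) * h <= (1 - delta) * r by rewrite ler_wpM2l //; lra.
  have : 0 < (1 - delta) * h by rewrite mulr_gt0 //; lra.
  lra.
have Omega1_le (e : R) : 0 < e -> \forall n \near \oo,
    prob_reg R (d n) (Omega1 n) <= e * (d n)%:R^-1.
  (* By [excl], localization forces [T n] to contain a vertex outside [J]; the threshold [2 / e]
     makes [2 / u <= e]. *)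
  move=> e0; apply: filterS (filterI excl (filterI (scale (28 + 2 / e))
    (filterI radius (filterI (degree 4) (small 1 ltr01))))).
  move=> n [ex [[]]]; set u := expR _ => uA nu du Ku eg [[z0 er] [d4 Ts]].
  have e2 : 0 < 2 / e by rewrite divr_gt0.
  have u28 : 28 <= u by lra.
  rewrite mul1r in Ts; have := prob_not_acyclic_le z0 u28 d4 nu du Ku eg Ts.
  move=> /(le_trans _)/le_trans; apply.
    by apply: le_unif_prob => E rE om TJ; apply: (ex E rE).
  rewrite ler_wpM2r ?invr_ge0 // ler_pdivrMr; last lra.
  by rewrite mulrC -ler_pdivrMr //; lra.
split; [|split].
(* With this error term the second claim reduces to the exponential factor being at most 1. *)
- exists (fun n => prob_reg R (d n) (Omega1 n)); split.
  + apply/(eqoP eventually_filterType (fun n : nat => (d n)%:R^-1 : R^o)) => e e0 /=.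
    apply: filterS (Omega1_le e e0) => n h.
    by rewrite !ger0_norm // ?invr_ge0 // unif_prob_ge0.
  + apply: filterS (filterI d_exists (degree 4)) => n [S0 d4].
    rewrite [leRHS]unif_probC // -[leRHS]mul1r ler_wpM2r ?subr_ge0 ?unif_prob_le1 //.
    by rewrite expR_le1 oppr_le0 divr_ge0 // mulr_ge0 // ltW // eta_gt0.
  (* For [x] the exponent and [q] the probability of [Omega1], the difference is at most [x + q];
     each gets half of [e]. *)
  + apply/(eqoP eventually_filterType (fun n : nat => (d n)%:R^-1 : R^o)) => e e0 /=.
    have e2 : 0 < e / 2 by rewrite divr_gt0.
    apply: filterS (filterI (degree 4) (filterI (Omega1_le _ e2) (small _ e2))) => n [d4 [om Ts]].
    have eta0 := eta_gt0 n d4; have D0 : 0 < (d n)%:R^-1 :> R by rewrite invr_gt0; lra.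
    set x := _ / (d n)%:R; set q := prob_reg _ _ _ in om *.
    have q0 : 0 <= q by apply: unif_prob_ge0.
    have x0 : 0 <= x by rewrite divr_ge0 // mulr_ge0 // ltW.
    have xe : x <= e / 2 * (d n)%:R^-1.
      by rewrite /x ler_wpM2r ?(ltW D0) // -ler_pdivlMr.
    have e1 : expR (- x) <= 1 by rewrite expR_le1 oppr_le0.
    have e3 : 1 - x <= expR (- x) := expR_ge1Dx _.
    have e4 : 0 < expR (- x) := expR_gt0 _.
    have h1 : 0 <= expR (- x) * q by rewrite mulr_ge0 // ltW.
    have h2 : expR (- x) * q <= q by rewrite ler_piMl.
    have h3 : 0 <= 1 - expR (- x) * (1 - q) by lra.
    rewrite !ger0_norm ?(ltW D0) //; lra.
- apply/(eqoP eventually_filterType (fun n : nat => n%:R^-1 : R^o)) => e e0 /=.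
  (* The threshold [16 / e] gives [16 / u^4 <= e]. *)
  apply: filterS (filterI d_exists (filterI (scale (28 + 16 / e)) (filterI radius (degree 4)))).
  move=> n [S0 [[]]]; set u := expR _ => uA nu du Ku eg [[z0 er] d4].
  have e16 : 0 < 16 / e by rewrite divr_gt0.
  have u28 : 28 <= u by lra.
  have u0 : 0 < u by lra.
  have u1 : 1 <= u by lra.
  rewrite -[prob_reg _ _ _]/(unif_prob _ _ _) -unif_probC // !ger0_norm ?invr_ge0 ?unif_prob_ge0 //.
  apply: le_trans (prob_few_acyclic z0 u28 d4 nu du Ku eg) _.
  rewrite ler_wpM2r ?invr_ge0 // ler_pdivrMr ?exprn_gt0 // mulrC -ler_pdivrMr //.
  apply: (@le_trans _ _ (u ^+ 1)); last exact: ler_weXn2l.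
  by rewrite expr1; lra.
- by apply: filterS excl => n ex; apply: unif_prob_eq0 => E /ex.
Qed.
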